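(* Let $\Omega$ be a nc set, $\mathcal A$ a unital $C^*$-algebra, $\mathcal Y$ a Hilbert space, and $K\colon\Omega\times\Omega\to\mathcal L(\mathcal A,\mathcal L(\mathcal Y))_{\rm nc}$ a cp global kernel. (1) Let $Z\in\Omega_n$, $W\in\Omega_m$. Then $K(Z,W)$ is completely bounded with $$\|K(Z,W)\|_{\rm cb}\le\left\|K\left(\begin{bmatrix}Z&0\\0&W\end{bmatrix},\begin{bmatrix}Z&0\\0&W\end{bmatrix}\right)(1_{\mathcal A^{(n+m)\times(n+m)}})\right\|=\max\{\|K(Z,Z)(1_{\mathcal A^{n\times n}})\|,\|K(W,W)(1_{\mathcal A^{m\times m}})\|\}.$$ Moreover $\left\|K\left(\begin{bmatrix}Z&0\\0&Z\end{bmatrix},\begin{bmatrix}Z&0\\0&Z\end{bmatrix}\right)\right\|_{\rm cb}=\|K(Z,Z)(1_{\mathcal A^{n\times n}})\|$. (2) Let $\mathcal H=\mathcal H(K)$ and $W\in\Omega_m$. Then for each $f\in\mathcal H(K)$, $f(W)\in\mathcal L(\mathcal A^m,\mathcal Y^m)$ is completely bounded with $$\|f(W)\|_{\mathcal L_{\rm cb}(\mathcal A^m,\mathcal Y^m)}\le\|f\|_{\mathcal H(K)}\,\|K(W,W)(1_{\mathcal A^{m\times m}})\|^{1/2}.$$ Moreover, for $r,s\in\mathbb N$, if $\mathbf{ev}^{(r,s)}_W\colon\mathcal H(K)\to\mathcal L((\mathcal A^m)^{r\times s},(\mathcal Y^m)^{r\times s})$ is the point-evaluation operator $f\mapsto\mathrm{id}_{\mathbb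 C^{r\times s}}\otimes f(W)$, then $$\|\mathbf{ev}^{(r,s)}_W\|=\sup_{V,\mathbf c}\left\|K\Big(\bigoplus_1^rW,\bigoplus_1^rW\Big)(V\mathbf c\mathbf c^*V^* )\right\|^{1/2},$$ where the supremum is over $V\in(\mathcal A^m)^{r\times s}\cong\mathcal A^{mr\times s}$ of norm at most $1$ and $\mathbf c\in\mathbb C^s$ of norm at most $1$. In particular $\|\mathbf{ev}^{(r,s)}_W\|\le\|K(W,W)(1_{\mathcal A^{m\times m}})\|^{1/2}$, and for $m=1$, with $\mathbf{ev}_W=\mathbf{ev}_W^{(1,1)}$, $$\|\mathbf{ev}_W\|_{\mathcal L(\mathcal H,\mathcal L(\mathcal A,\mathcal Y))}=\|\mathbf{ev}_W\|_{\mathcal L(\mathcal H,\mathcal L_{\rm cb}(\mathcal A,\mathcal Y))}=\|K(W,W)(1_{\mathcal A})\|^{1/2}.$$ (3) Let $H\colon\Omega\to\mathcal L(\mathcal X,\mathcal Y)_{\rm nc}$ be the global function in a Kolmogorov decomposition of $K$, and let $Z\in\Omega_n$. Then $H(Z)\colon\mathcal X^n\to\mathcal Y^n$ is completely bounded with $$\|H(Z)\|_{\rm cb}=\|H(Z)\|=\|K(Z,Z)(1_{\mathcal A^{n\times n}})\|^{1/2}.$$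
   Context: For a set $\mathcal S$, $\mathcal S_{\rm nc}=\coprod_{n\ge1}\mathcal S^{n\times n}$; $\Omega\subset\mathcal S_{\rm nc}$ is a nc set if closed under direct sums $(Z,W)\mapsto\begin{bmatrix}Z&0\\0&W\end{bmatrix}$; $\Omega_n=\Omega\cap\mathcal S^{n\times n}$. $\bigoplus_1^rW$ is the $r$-fold direct sum. $\mathcal L(\mathcal X,\mathcal Y)^{n\times n}\cong\mathcal L(\mathcal X^n,\mathcal Y^n)$ (bounded operators). A global function $f\colon\Omega\to\mathcal L(\mathcal X,\mathcal Y)_{\rm nc}$ satisfies $f(Z)\in\mathcal L(\mathcal X,\mathcal Y)^{n\times n}$ for $Z\in\Omega_n$ and $f\left(\begin{bmatrix}Z&0\\0&W\end{bmatrix}\right)=\begin{bmatrix}f(Z)&0\\0&f(W)\end{bmatrix}$. A global kernel $K\colon\Omega\times\Omega\to\mathcal L(\mathcal A,\mathcal L(\mathcal Y))_{\rm nc}$ assigns to $Z\in\Omega_n$, $W\in\Omega_m$ a linear map $K(Z,W)\colon\mathcal A^{n\times m}\to\mathcal L(\mathcal Y)^{n\times m}\cong\mathcal L(\mathcal Y^m,\mathcal Y^n)$ such that $$K\left(\begin{bmatrix}Z&0\\ 0&\widetilde Z\end{bmatrix},\begin{bmatrix}W&0\\ 0&\widetilde W\end{bmatrix}\right)\left(\begin{bmatrix}P_{11}&P_{12}\\ P_{21}&P_{22}\end{bmatrix}\right)=\begin{bmatrix}K(Z,W)(P_{11})&K(Z,\widetilde W)(P_{12})\\ K(\widetilde Z,W)(P_{21})&K(\widetilde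 Z,\widetilde W)(P_{22})\end{bmatrix}.$$ It is cp if $K(Z,Z)(P)\succeq0$ whenever $Z\in\Omega_n$, $P\succeq0$ in $\mathcal A^{n\times n}$, $n\in\mathbb N$. A Kolmogorov decomposition of $K$: a Hilbert space $\mathcal X$, a unital $*$-representation $\sigma\colon\mathcal A\to\mathcal L(\mathcal X)$ and a global function $H\colon\Omega\to\mathcal L(\mathcal X,\mathcal Y)_{\rm nc}$ with $K(Z,W)(P)=H(Z)(\mathrm{id}_{\mathbb C^{n\times m}}\otimes\sigma)(P)H(W)^*$ ($\mathrm{id}\otimes\sigma$ is $\sigma$ applied entrywise). $\mathcal A^n$ denotes columns, $\mathcal A^{1\times m}$ rows over $\mathcal A$; $V^*$ is conjugate transpose. $\mathcal H(K)$ is the unique Hilbert space of global functions $f\colon\Omega\to\mathcal L(\mathcal A,\mathcal Y)_{\rm nc}$ such that: (a) for $W\in\Omega_m$, $v\in\mathcal A^{1\times m}$, $y\in\mathcal Y^m$ the function $K_{W,v,y}(Z)u=K(Z,W)(uv)y$ ($Z\in\Omega_n$, $u\in\mathcal A^n$) belongs to $\mathcal H(K)$; (b) $\langle f(W)(v^* ),y\rangle_{\mathcal Y^m}=\langle f,K_{W,v,y}\rangle_{\mathcal H(K)}$ for $f\in\mathcal H(K)$; (c) $(\sigma(a)f)(W)(v^* )=f(W)(v^*a)$ defines a unital $*$-representation of $\mathcal A$ on $\mathcal H(K)$. Operator-space conventions: matrices over the $C^*$-algebra $\mathcal A$ carry the norms induced from a faithful representation $\mathcal A\subset\mathcal L(\mathcal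 E)$, $\mathcal A^{p\times q}\subset\mathcal L(\mathcal E^q,\mathcal E^p)$; in particular $(\mathcal A^m)^{r\times s}\cong\mathcal A^{mr\times s}$, where $\mathcal A^m=\mathcal A^{m\times1}$. Hilbert spaces carry the column structure: $\mathcal Y\cong\mathcal L(\mathbb C,\mathcal Y)$, so $(\mathcal Y^m)^{r\times s}\cong\mathcal L(\mathbb C^s,\mathcal Y^{mr})$. For a linear map $\varphi$ between operator spaces, $\mathrm{id}_{\mathbb C^{r\times s}}\otimes\varphi\colon[v_{ij}]\mapsto[\varphi(v_{ij})]$, and $\varphi$ is completely bounded if $\|\varphi\|_{\rm cb}=\sup_N\|\mathrm{id}_{\mathbb C^{N\times N}}\otimes\varphi\|<\infty$; $\mathcal L_{\rm cb}$ denotes the space of completely bounded maps with norm $\|\cdot\|_{\rm cb}$. *)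

(* Defs.v *)
From HB Require Import structures.
From mathcomp Require Import all_boot all_order all_algebra.
From mathcomp Require Import complex.
From mathcomp Require Import all_classical all_reals all_analysis.

Set Implicit Arguments.
Unset Strict Implicit.
Unset Printing Implicit Defensive.

Import Order.TTheory GRing.Theory Num.Theory.
Import numFieldNormedType.Exports.

Local Open Scope classical_set_scope.
Local Open Scope ring_scope.
Local Open Scope complex_scope.

(* Inner products are linear in the first variable.  The norm of a normed
   module over [R[i]] takes its values in [R[i]]. *)
HB.mixin Record CompleteNormedModule_isHilbert (R : realType) V
    & CompleteNormedModule R[i] V := {
  hdot : {dot V for @Num.conj R[i]};
  hdot_norm : forall x : V, hdot x x = `|x| ^+ 2
}.

#[short(type="hilbertType")]
HB.structure Definition Hilbert (R : realType) :=
  {V of CompleteNormedModule R[i] V & CompleteNormedModule_isHilbert R V}.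

Definition rnorm (R : realType) (V : normedZmodType R[i]) (x : V) : R :=
  complex.Re `|x|.

(* The norm of a C*-algebra is a field of the structure, because MathComp's
   hierarchy has no join of [GRing.Algebra] with the normed modules. *)
HB.mixin Record isCStarAlgebra (R : realType) A & GRing.Algebra R[i] A := {
  cnorm : A -> R;
  cnormD : forall a b : A, cnorm (a + b) <= cnorm a + cnorm b;
  cnormZ : forall (c : R[i]) (a : A), cnorm (c *: a) = rnorm c * cnorm a;
  cnorm_eq0 : forall a : A, cnorm a = 0 -> a = 0;
  cnormM : forall a b : A, cnorm (a * b) <= cnorm a * cnorm b;
  cnorm_complete : forall u : nat -> A,
    (forall e : R, 0 < e -> exists N : nat, forall m n : nat,
       (N <= m)%N -> (N <= n)%N -> cnorm (u m - u n) < e) ->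
    exists l : A, forall e : R, 0 < e -> exists N : nat, forall n : nat,
      (N <= n)%N -> cnorm (u n - l) < e;
  star : A -> A;
  starD : {morph star : a b / a + b};
  starZ : forall (c : R[i]) (a : A), star (c *: a) = Num.conj c *: star a;
  starM : forall a b : A, star (a * b) = star b * star a;
  starK : involutive star;
  cstar_norm : forall a : A, cnorm (star a * a) = cnorm a ^+ 2
}.

#[short(type="cstarType")]
HB.structure Definition CStarAlgebra (R : realType) :=
  {A of GRing.Algebra R[i] A & isCStarAlgebra R A}.

Section Columns.
Context {R : realType}.

Definition mx_act {V X : Type} {Y : zmodType} (act : V -> X -> Y) p q
    (T : 'M[V]_(p, q)) (x : 'cV[X]_q) : 'cV[Y]_p :=
  \col_i \sum_j act (T i j) (x j 0).

(* The identification of [L(X, Y)^(p x q)] with operators [X^q -> Y^p]. *)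
Definition mx_app {X : Type} {Y : zmodType} p q (T : 'M[X -> Y]_(p, q)) :
  'cV[X]_q -> 'cV[Y]_p := mx_act (fun t x => t x) T.

Definition col_norm {X : Type} (nX : X -> R) n (x : 'cV[X]_n) : R :=
  Num.sqrt (\sum_i nX (x i 0) ^+ 2).

Definition col_dot {Y : hilbertType R} n (x y : 'cV[Y]_n) : R[i] :=
  \sum_i hdot (x i 0) (y i 0).

Definition star_mx {A : cstarType R} p q (P : 'M[A]_(p, q)) : 'M[A]_(q, p) :=
  \matrix_(i, j) star (P j i).

End Columns.

Section Operators.
Context {R : realType}.

Definition bounded_op {X Y : normedModType R[i]} (T : X -> Y) : Prop :=
  linear T /\ exists M : R[i], forall x, `|T x| <= M * `|x|.

Definition adjoint {X Y : hilbertType R} (T : X -> Y) (y : Y) : X :=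
  xget 0 [set z | forall x, hdot (T x) y = hdot x z].

Definition adjoint_mx {X Y : hilbertType R} p q (T : 'M[X -> Y]_(p, q)) :
  'M[Y -> X]_(q, p) := \matrix_(i, j) adjoint (T j i).

Definition pos_op {Y : hilbertType R} n (T : 'M[Y -> Y]_n) : Prop :=
  forall y : 'cV[Y]_n, 0 <= col_dot (mx_app T y) y.

Definition pos_mx {A : cstarType R} n (P : 'M[A]_n) : Prop :=
  exists Q : 'M[A]_n, P = star_mx Q *m Q.

Record star_rep {A : cstarType R} {X : hilbertType R} (s : A -> X -> X) :
    Prop := StarRep {
  rep_bounded : forall a, bounded_op (s a);
  rep_linear : forall (c : R[i]) a b x, s (c *: a + b) x = c *: s a x + s b x;
  rep_mul : forall a b x, s (a * b) x = s a (s b x);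
  rep_star : forall a x y, hdot (s a x) y = hdot x (s (star a) y);
  rep_unit : forall x, s 1 x = x
}.

Definition faithful_rep {A : cstarType R} {X : hilbertType R}
  (s : A -> X -> X) : Prop := star_rep s /\ injective s.

End Operators.

Section OperatorSpaces.
Context {R : realType}.
Local Open Scope ereal_scope.

Definition opnorm {U V : Type} (nU : U -> \bar R) (nV : V -> \bar R)
    (T : U -> V) : \bar R :=
  ereal_sup [set nV (T u) | u in [set u | nU u <= 1]].

(* A space whose elements are regarded as operators [os_dom -> os_cod] between
   Hilbert spaces; amplifications then act on columns with the l2 norm. *)
Record opspace (V : Type) := OpSpace {
  os_dom : zmodType;
  os_cod : zmodType;
  os_ndom : os_dom -> R;
  os_ncod : os_cod -> R;
  os_act : V -> os_dom -> os_cod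
}.

Arguments os_ndom {V} o _.
Arguments os_ncod {V} o _.
Arguments os_act {V} o _ _.

Definition os_norm {V : Type} (c : opspace V) (v : V) : \bar R :=
  opnorm (fun x => (os_ndom c x)%:E) (fun y => (os_ncod c y)%:E) (os_act c v).

Definition os_mx {V : Type} p q (c : opspace V) : opspace 'M[V]_(p, q) :=
  @OpSpace 'M[V]_(p, q) 'cV[os_dom c]_q 'cV[os_cod c]_p
    (fun x => col_norm (os_ndom c) x) (fun y => col_norm (os_ncod c) y)
    (fun T => mx_act (os_act c) T).

Definition os_alg {A : cstarType R} {E : hilbertType R} (rho : A -> E -> E) :
  opspace A := @OpSpace A E E (@rnorm R E) (@rnorm R E) rho.

Definition os_op (X Y : hilbertType R) : opspace (X -> Y) :=
  @OpSpace (X -> Y) X Y (@rnorm R X) (@rnorm R Y) (fun t x => t x).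

(* The column structure, from the identification of [Y] with [L(C, Y)]. *)
Definition os_col (Y : hilbertType R) : opspace Y :=
  @OpSpace Y R[i] Y (@rnorm R R[i]) (@rnorm R Y) (fun y c => (c *: y)%R).

Definition map_norm {V W : Type} (c : opspace V) (d : opspace W)
  (phi : V -> W) : \bar R := opnorm (os_norm c) (os_norm d) phi.

Definition amp_norm {V W : Type} (c : opspace V) (d : opspace W) r s
    (phi : V -> W) : \bar R :=
  map_norm (os_mx r s c) (os_mx r s d) (map_mx phi).

Definition cb_norm {V W : Type} (c : opspace V) (d : opspace W)
    (phi : V -> W) : \bar R :=
  ereal_sup [set amp_norm c d N N phi | N in [set N | (0 < N)%N]].

Definition op_norm {X Y : hilbertType R} p q (T : 'M[X -> Y]_(p, q)) :
  \bar R := os_norm (os_mx p q (os_op X Y)) T.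

End OperatorSpaces.

Section Global.
Context {R : realType} {S : Type} (s0 : S).

Definition dsum {T : Type} (z : T) n m (Z : 'M[T]_n) (W : 'M[T]_m) :
  'M[T]_(n + m) := block_mx Z (const_mx z) (const_mx z) W.

Fixpoint dsum_iter r m (W : 'M[S]_m) : 'M[S]_(r * m) :=
  match r with
  | 0 => const_mx s0
  | r'.+1 => dsum s0 W (dsum_iter r' W)
  end.

(* [s0] is the distinguished element of [S] that fills the off-diagonal blocks.
   Matrices of size 0 are not points of a nc set. *)
Definition nc_set (Omega : forall n, set 'M[S]_n) : Prop :=
  (forall Z, ~ Omega 0%N Z) /\
  (forall n m Z W, Omega n Z -> Omega m W -> Omega (n + m)%N (dsum s0 Z W)).

Variable Omega : forall n, set 'M[S]_n.
Arguments Omega : clear implicits.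

(* Only the values at points of [Omega] are constrained; [isop] singles out the
   operators [X -> Y] that are allowed as entries of the values. *)
Definition global_fun {X : Type} {Y : zmodType} (isop : (X -> Y) -> Prop)
    (f : forall n, 'M[S]_n -> 'M[X -> Y]_n) : Prop :=
  (forall n Z, Omega n Z -> forall i j, isop (f n Z i j)) /\
  (forall n m Z W, Omega n Z -> Omega m W ->
     f _ (dsum s0 Z W) = dsum (fun=> 0) (f n Z) (f m W)).

Context {A : cstarType R} {Y : hilbertType R}.
Variable K : forall n m,
  'M[S]_n -> 'M[S]_m -> 'M[A]_(n, m) -> 'M[Y -> Y]_(n, m).

Record global_kernel : Prop := GlobalKernel {
  gk_linear : forall n m Z W, Omega n Z -> Omega m W ->
    forall (c : R[i]) P Q i j y,
      K Z W (map_mx ( *:%R c) P + Q) i j y =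
      c *: K Z W P i j y + K Z W Q i j y;
  gk_bounded : forall n m Z W, Omega n Z -> Omega m W ->
    forall P i j, bounded_op (K Z W P i j);
  gk_dsum : forall n n' m m' Z Z' W W',
    Omega n Z -> Omega n' Z' -> Omega m W -> Omega m' W' ->
    forall P11 P12 P21 P22,
      K (dsum s0 Z Z') (dsum s0 W W') (block_mx P11 P12 P21 P22) =
      block_mx (K Z W P11) (K Z W' P12) (K Z' W P21) (K Z' W' P22)
}.

Definition cp_kernel : Prop :=
  forall n Z, Omega n Z -> forall P, pos_mx P -> pos_op (K Z Z P).

Record kolmogorov {X : hilbertType R} (sigma : A -> X -> X)
    (H : forall n, 'M[S]_n -> 'M[X -> Y]_n) : Prop := Kolmogorov {
  kol_rep : star_rep sigma;
  kol_global : global_fun bounded_op H;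
  kol_eq : forall n m Z W, Omega n Z -> Omega m W -> forall P y,
    mx_app (K Z W P) y =
    mx_app (H n Z) (mx_app (map_mx sigma P) (mx_app (adjoint_mx (H m W)) y))
}.

(* [F], with evaluation [ev], is the Hilbert space H(K): [ev f] is the global
   function that the element [f] of [F] is, and [rk_inj] says that [f] is
   determined by it.  [rk_mem], [rk_rep] and [rk_alg] are the conditions on
   kernel elements, reproducing property and representation of [A]. *)
Record is_rkhs (F : hilbertType R)
    (ev : F -> forall n, 'M[S]_n -> 'M[A -> Y]_n) : Prop := IsRKHS {
  rk_global : forall f, global_fun (fun t : A -> Y => linear t) (ev f);
  rk_linear : forall (c : R[i]) f g n Z, Omega n Z -> forall i j a,
    ev (c *: f + g) n Z i j a = c *: ev f n Z i j a + ev g n Z i j a;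
  rk_inj : forall f g, (forall n Z, Omega n Z -> ev f n Z = ev g n Z) -> f = g;
  rk_mem : forall m W, Omega m W -> forall (v : 'rV[A]_m) (y : 'cV[Y]_m),
    exists k : F, forall n Z, Omega n Z -> forall u : 'cV[A]_n,
      mx_app (ev k n Z) u = mx_app (K Z W (u *m v)) y;
  rk_rep : forall m W, Omega m W -> forall (v : 'rV[A]_m) (y : 'cV[Y]_m) k,
    (forall n Z, Omega n Z -> forall u : 'cV[A]_n,
       mx_app (ev k n Z) u = mx_app (K Z W (u *m v)) y) ->
    forall f, col_dot (mx_app (ev f m W) (star_mx v)) y = hdot f k;
  rk_alg : exists2 sigma : A -> F -> F, star_rep sigma &
    forall a f m W, Omega m W -> forall v : 'rV[A]_m,
      mx_app (ev (sigma a f) m W) (star_mx v) =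
      mx_app (ev f m W) (map_mx (fun b => b * a) (star_mx v))
}.

End Global.

Section Evaluation.
Context {R : realType} {S : Type} {A : cstarType R} {E Y F : hilbertType R}.
Local Open Scope ereal_scope.

Definition ev_norm (rho : A -> E -> E)
    (ev : F -> forall n, 'M[S]_n -> 'M[A -> Y]_n) m (W : 'M[S]_m) r s :
    \bar R :=
  opnorm (fun f : F => (rnorm f)%:E)
    (map_norm (os_mx r s (os_mx m 1 (os_alg rho)))
              (os_mx r s (os_mx m 1 (os_col Y))))
    (fun f => map_mx (mx_app (ev f m W))).

(* [V c c^* V^*], with the scalar matrix [c c^*] regarded as a matrix over A. *)
Definition rank_one {p s} (V : 'M[A]_(p, s)) (c : 'cV[R[i]]_s) : 'M[A]_p :=
  (V *m map_mx (fun z : R[i] => z%:A) (c *m map_mx Num.conj c^T) *m star_mx V)%R.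

End Evaluation.

(* Main.v *)
(* A contractive matrix P over A yields the positive matrix [[1, P], [P^*, 1]],
   so that complete positivity at the direct sum of a point with itself gives
   |<K(V, V)(P) y, x>|^2 <= <K(V, V)(1) x, x> <K(V, V)(1) y, y>.  For V a
   multiple of the direct sum of Z and W this bounds the cb norm of K(Z, W),
   because K is compatible with direct sums.  In H(K) the reproducing property
   turns sum_k <f(W)(u_k), y_k> into <f, k> with |k|^2 = <K(rW, rW)(P) y, y> and
   P = u u^*, which yields the formula for the norms of the evaluations.  In a
   Kolmogorov decomposition K(Z, Z)(1) = T T^* with T = H(Z), and
   |T|^2 = |T T^*|.

   Positivity of 1 - P P^* in the matrices over A is needed in the algebraic
   sense Q^* Q, whereas contractivity is measured in the representation rho.
   This requires that rho be isometric, and a square root in the matrices over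
   A; both come from a square-root iteration that only needs the powers of the
   argument to be bounded. *)

Require Import Defs.
From HB Require Import structures.
From mathcomp Require Import all_boot all_order all_algebra.
From mathcomp Require Import complex mxtens ring lra.
From mathcomp Require Import all_classical all_reals all_analysis.

Set Implicit Arguments.
Unset Strict Implicit.
Unset Printing Implicit Defensive.

Import Order.TTheory GRing.Theory Num.Theory.
Import numFieldNormedType.Exports.

Local Open Scope classical_set_scope.
Local Open Scope ring_scope.
Local Open Scope complex_scope.

(** * Square roots in complete normed rings with involution *)

(** Matrices over [A] get only the entrywise sum norm, which is complete and submultiplicative but
    is not a C*-norm: a contraction can have norm larger than 1 there. What survives is that its
    powers stay bounded, because every entry of a contraction has norm at most 1. Hence the
    square-root series is controlled by the total mass of its nonnegative coefficients, not by a
    bound on the norm of the argument. The entry bound needs [rho] to be norm-increasing as well as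
    contractive, and this is where injectivity enters. Most upper bounds share one device: a Schwarz
    inequality is tested against the image vector itself, which gives s^2 <= s c for the squared
    norm s of the image, and s is cancelled. Amplifications of every size are the same inequality at
    an iterated direct sum, so complete boundedness costs no more than boundedness. *)

Section SquareRoot.
Context {R : realType} {B : pzRingType} (N : B -> R) (s : B -> B) (h : B).

(* [h] plays the role of the scalar 1/2; no algebra structure is assumed,
   because MathComp has none on the matrices over an algebra. *)
Record normed_star_ring : Prop := NormedStarRing {
  nsrD : forall x y, N (x + y) <= N x + N y;
  nsrN : forall x, N (- x) = N x;
  nsrM : forall x y, N (x * y) <= N x * N y;
  nsr0 : N 0 = 0;
  nsr_eq0 : forall x, N x = 0 -> x = 0;
  nsr_complete : forall u : nat -> B,
    (forall e : R, 0 < e -> exists M : nat, forall m n : nat,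
       (M <= m)%N -> (M <= n)%N -> N (u m - u n) < e) ->
    exists l : B, forall e : R, 0 < e -> exists M : nat, forall n : nat,
      (M <= n)%N -> N (u n - l) < e;
  nsr_starN : forall x, N (s x) = N x;
  nsr_starD : forall x y, s (x + y) = s x + s y;
  nsr_starM : forall x y, s (x * y) = s y * s x;
  nsr_star1 : s 1 = 1;
  nsr_starh : s h = h;
  nsr_half : h + h = 1;
  nsr_halfC : forall x, h * x = x * h;
  nsr_halfN : forall x, N (h * x) <= N x / 2
}.

Hypothesis nsr : normed_star_ring.

(* Combinations of powers of [b] with nonnegative dyadic coefficients of total
   mass [t]. *)
Inductive dyadic (b : B) : R -> B -> Prop :=
| dyadic0 : dyadic b 0 0
| dyadicX i : dyadic b 1 (b ^+ i)
| dyadicD t u x y : dyadic b t x -> dyadic b u y -> dyadic b (t + u) (x + y)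
| dyadicH t x : dyadic b t x -> dyadic b (t / 2) (h * x).

Lemma dyadicM b t u x y : dyadic b t x -> dyadic b u y -> dyadic b (t * u) (x * y).
Proof.
move=> dx; elim: dx u y => [|i|t1 t2 x1 x2 _ IH1 _ IH2|t1 x1 _ IH] u y dy.
- by rewrite !mul0r; apply: dyadic0.
- elim: dy => [|j|t1 t2 x1 x2 _ IH1 _ IH2|t1 x1 _ IH].
  + by rewrite !mulr0; apply: dyadic0.
  + by rewrite mulr1 -exprD; apply: dyadicX.
  + by rewrite !mulrDr; apply: dyadicD.
  + by rewrite mulrA (mulrA _ h) -(nsr_halfC nsr) -(mulrA h); apply: dyadicH.
- by rewrite !mulrDl; apply: dyadicD; [apply: IH1|apply: IH2].
- by rewrite mulrAC -(mulrA h); apply: dyadicH; apply: IH.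
Qed.

(** Since the coefficients are nonnegative, the mass is their l1 norm. Only a common bound on the
    powers is used, so [N b] may exceed 1. *)
Lemma dyadic_norm b C t x : 0 <= C -> (forall k, N (b ^+ k) <= C) ->
  dyadic b t x -> N x <= C * t.
Proof.
move=> C0 bC; elim => [|i|t1 t2 x1 x2 _ IH1 _ IH2|t1 x1 _ IH].
- by rewrite (nsr0 nsr) mulr0.
- by rewrite mulr1.
- by rewrite mulrDr; apply: le_trans (nsrD nsr _ _) _; apply: lerD.
- apply: le_trans (nsr_halfN nsr _) _; rewrite mulrA.
  by rewrite ler_pM2r // invr_gt0.
Qed.

Lemma dyadic_comm b c t x : c * b = b * c -> dyadic b t x -> c * x = x * c.
Proof.
move=> cb; elim => [|i|t1 t2 x1 x2 _ IH1 _ IH2|t1 x1 _ IH].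
- by rewrite mulr0 mul0r.
- by apply: commrX.
- by rewrite mulrDr mulrDl IH1 IH2.
- by rewrite mulrA -(nsr_halfC nsr) -!mulrA IH.
Qed.

Lemma star0 : s 0 = 0.
Proof.
by apply: (addrI (s 0)); rewrite -(nsr_starD nsr) !addr0.
Qed.

Lemma dyadic_star b t x : s b = b -> dyadic b t x -> s x = x.
Proof.
move=> sb; elim => [|i|t1 t2 x1 x2 _ IH1 _ IH2|t1 x1 _ IH].
- exact: star0.
- elim: i => [|i IH]; first by rewrite expr0 (nsr_star1 nsr).
  by rewrite exprSr (nsr_starM nsr) IH sb -exprS exprSr.
- by rewrite (nsr_starD nsr) IH1 IH2.
- by rewrite (nsr_starM nsr) IH (nsr_starh nsr) (nsr_halfC nsr).
Qed.

(* The iteration [y := (b + y^2) / 2] converges to [1 - sqrt (1 - b)]; its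
   increments are dyadic combinations of powers of [b] whose masses follow the
   scalar iteration for [b = 1]. *)
Fixpoint sqrt_iter (b : B) n : B :=
  if n is n'.+1 then h * (b + sqrt_iter b n' * sqrt_iter b n') else 0.

Fixpoint sqrt_mass n : R :=
  if n is n'.+1 then (1 + sqrt_mass n' * sqrt_mass n') / 2 else 0.

Lemma sqrt_iterS b n :
  sqrt_iter b n.+1 = h * (b + sqrt_iter b n * sqrt_iter b n).
Proof. by []. Qed.

Lemma sqrt_massS n :
  sqrt_mass n.+1 = (1 + sqrt_mass n * sqrt_mass n) / 2.
Proof. by []. Qed.

Lemma sqrt_mass_itv n : 0 <= sqrt_mass n <= 1.
Proof. by elim: n => [|n /andP[IH1 IH2]] /=; [lra|apply/andP; split; nra]. Qed.

Lemma dyadic_iter b n : dyadic b (sqrt_mass n) (sqrt_iter b n).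
Proof.
elim: n => [|n IH] /=; first exact: dyadic0.
by apply/dyadicH/dyadicD; [rewrite -[b in X in dyadic _ _ X]expr1; apply: dyadicX|apply: dyadicM].
Qed.

(** An increment is half of a difference of squares. Iterates are combinations of powers of [b] and
    commute, so it factors into the previous increment and a sum of iterates, both with nonnegative
    coefficients. *)
Lemma dyadic_step b n :
  dyadic b (sqrt_mass n.+1 - sqrt_mass n) (sqrt_iter b n.+1 - sqrt_iter b n).
Proof.
elim: n => [|n IH].
  rewrite /= !mulr0 !addr0 !subr0; apply: dyadicH; rewrite -[b in X in dyadic _ _ X]expr1.
  exact: dyadicX.
have -> : sqrt_mass n.+2 - sqrt_mass n.+1 =
    ((sqrt_mass n.+1 - sqrt_mass n) * (sqrt_mass n.+1 + sqrt_mass n)) / 2.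
  by rewrite (sqrt_massS n.+1) {3}(sqrt_massS n); field.
have -> : sqrt_iter b n.+2 - sqrt_iter b n.+1 =
    h * ((sqrt_iter b n.+1 - sqrt_iter b n) * (sqrt_iter b n.+1 + sqrt_iter b n)).
  rewrite (sqrt_iterS _ n.+1) {3}(sqrt_iterS _ n) -mulrBr; congr (_ * _).
  have cb k : sqrt_iter b k * b = b * sqrt_iter b k.
    by apply/esym/dyadic_comm/dyadic_iter.
  have -> : sqrt_iter b n.+1 * sqrt_iter b n.+1 = sqrt_iter b n.+1 ^+ 2 by [].
  have -> : sqrt_iter b n * sqrt_iter b n = sqrt_iter b n ^+ 2 by [].
  rewrite opprD addrACA subrr add0r subrXX_comm; last first.
    exact: dyadic_comm (dyadic_iter _ _).
  by rewrite !big_ord_recl big_ord0 /= expr0 !expr1 mulr1 mul1r addr0 addrC.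
by apply/dyadicH/dyadicM; [|apply/dyadicD; apply: dyadic_iter].
Qed.

Lemma dyadic_iterB b n k :
  dyadic b (sqrt_mass (n + k) - sqrt_mass n) (sqrt_iter b (n + k) - sqrt_iter b n).
Proof.
elim: k => [|k IH]; first by rewrite addn0 !subrr; apply: dyadic0.
have := dyadicD IH (dyadic_step b (n + k)).
by rewrite addnS [X in dyadic _ X _]addrC [X in dyadic _ _ X]addrC !addrA !subrK.
Qed.

Lemma sqrt_iter_cauchy b C : (forall k, N (b ^+ k) <= C) ->
  forall e : R, 0 < e -> exists M : nat, forall m n : nat,
       (M <= m)%N -> (M <= n)%N -> N (sqrt_iter b m - sqrt_iter b n) < e.
Proof.
move=> bC e e0.
have C0 : 0 <= C + 1.
  have := bC 0; have := nsrD nsr (b ^+ 0) (- b ^+ 0).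
  by rewrite subrr (nsr0 nsr) (nsrN nsr); lra.
have bC1 k : N (b ^+ k) <= C + 1 by apply: le_trans (bC k) _; lra.
(* The masses increase and stay below 1. Beyond an index where the mass is close to its supremum,
   only little mass remains, which bounds the tails of the iteration. *)
pose T := [set sqrt_mass n | n in setT].
have supT : has_sup T.
  split; first by exists (sqrt_mass 0), 0.
  by exists 1 => _ [n _ <-]; case/andP: (sqrt_mass_itv n).
pose e' := e / (2 * (C + 2)).
have C2 : 0 < 2 * (C + 2) by lra.
have e'0 : 0 < e' by rewrite divr_gt0.
have [_ [M _ <-] TM] := sup_adherent e'0 supT; exists M.
have key k : N (sqrt_iter b (M + k) - sqrt_iter b M) < e / 2.
  have := dyadic_norm C0 bC1 (dyadic_iterB b M k) => /le_lt_trans; apply.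
  have h1 : sqrt_mass (M + k) - sqrt_mass M < e'.
    have : sqrt_mass (M + k) <= sup T by apply: sup_upper_bound => //; exists (M + k)%N.
    by lra.
  (* The mass of any dyadic combination is nonnegative; applied to a tail, this is the monotonicity
     of the masses. *)
  have : sqrt_mass (M + k) - sqrt_mass M >= 0.
    have: dyadic b (sqrt_mass (M + k) - sqrt_mass M) (sqrt_iter b (M + k) - sqrt_iter b M).
      exact: dyadic_iterB.
    by elim; rewrite ?ler01 // => *; lra.
  have -> : e / 2 = e' * (C + 2) by rewrite /e'; field; lra.
  by nra.
move=> m n Mm Mn.
have -> : sqrt_iter b m - sqrt_iter b n = (sqrt_iter b (M + (m - M)) - sqrt_iter b M)
   - (sqrt_iter b (M + (n - M)) - sqrt_iter b M).
  by rewrite !subnKC // opprB addrA subrK.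
apply: le_lt_trans (nsrD nsr _ _) _; rewrite (nsrN nsr).
by have := key (m - M)%N; have := key (n - M)%N; lra.
Qed.

Lemma nsr_ge0 x : 0 <= N x.
Proof.
by have := nsrD nsr x (- x); rewrite subrr (nsr0 nsr) (nsrN nsr); lra.
Qed.

Lemma nsr_small x K : (forall e : R, 0 < e -> N x <= K * e) -> x = 0.
Proof.
move=> xK; apply: (nsr_eq0 nsr); apply/eqP; rewrite eq_le nsr_ge0 andbT.
have [K0|K0] := leP K 0.
  by have := xK 1 ltr01; lra.
apply/ler_addgt0Pr => e e0; rewrite add0r.
by have := xK (e / K) (divr_gt0 e0 K0); rewrite mulrCA divff ?mulr1 // gt_eqF.
Qed.

(** The limit solves 2y = b + y^2. The other conclusions hold for all iterates and pass to the
    limit; the bound on [y] allows the lemma to be applied again to [y], giving a square root of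
    [1 - y]. *)
Lemma sqrt_one_minus b C : (forall k, N (b ^+ k) <= C) ->
  exists y, [/\ (1 - y) ^+ 2 = 1 - b, N y <= C,
    forall c, c * b = b * c -> c * y = y * c & s b = b -> s y = y].
Proof.
move=> bC; have C0 : 0 <= C by apply: le_trans (nsr_ge0 _) (bC 0).
have [y yl] := nsr_complete nsr (sqrt_iter_cauchy bC).
have yC n : N (sqrt_iter b n) <= C.
  apply: le_trans (dyadic_norm C0 bC (dyadic_iter b n)) _.
  by have := sqrt_mass_itv n; nra.
have Ny : N y <= C.
  apply/ler_addgt0Pr => e /yl[M /(_ M (leqnn M)) My].
  have -> : y = sqrt_iter b M - (sqrt_iter b M - y) by rewrite opprB addrC subrK.
  apply: le_trans (nsrD nsr _ _) _; rewrite (nsrN nsr).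
  by have := yC M; lra.
exists y; split=> //.
- have fix_y : y = h * (b + y * y).
    apply/subr0_eq/(@nsr_small _ (1 + C)) => e /yl[M My].
    set z := sqrt_iter b M.
    (* The defect of the fixed-point equation consists of two tails. The splitting of z^2 - y^2 is
       valid without commutation of [z] and [y]. *)
    have -> : y - h * (b + y * y) =
        - (sqrt_iter b M.+1 - y) + h * ((z - y) * z + y * (z - y)).
        have -> : (z - y) * z + y * (z - y) = z * z - y * y.
        by rewrite mulrBl mulrBr addrA subrK.
      rewrite sqrt_iterS -/z opprB -addrA; congr (y + _).
      by rewrite -(mulrN h (b + y * y)) -(mulrN h (b + z * z)) -mulrDr !opprD addrA subrK.
    apply: le_trans (nsrD nsr _ _) _; rewrite (nsrN nsr).
    have h1 := My _ (leqnSn M).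
    have h2 := My _ (leqnn M).
    have h3 := nsr_halfN nsr ((z - y) * z + y * (z - y)).
    have h4 := nsrD nsr ((z - y) * z) (y * (z - y)).
    have h5 := nsrM nsr (z - y) z.
    have h6 := nsrM nsr y (z - y).
    have := yC M; have := nsr_ge0 (z - y); have := nsr_ge0 z; have := nsr_ge0 y.
    rewrite -/z in h2 * => n1 n2 n3 n4.
    have h7 : N (z - y) * N z <= e * C by apply: ler_pM => //; apply: ltW.
    have h8 : N y * N (z - y) <= e * C.
      by rewrite [leRHS]mulrC; apply: ler_pM => //; apply: ltW.
    by lra.
  have y2 : y + y = b + y * y.
    by rewrite {1 2}fix_y -mulrDl (nsr_half nsr) mul1r.
  rewrite expr2 mulrBl mul1r mulrBr mulr1 opprB -addrA; congr (1 + _).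
  by rewrite addrCA -opprD y2 opprD addrCA subrr addr0.
- move=> c cb; apply/subr0_eq/(@nsr_small _ (2 * N c)) => e /yl[M /(_ M (leqnn M)) My].
  have cz := dyadic_comm cb (dyadic_iter b M); set z := sqrt_iter b M in My cz.
  have -> : c * y - y * c = (z - y) * c - c * (z - y).
    by rewrite mulrBl mulrBr cz opprB [RHS]addrC addrA subrK.
  apply: le_trans (nsrD nsr _ _) _; rewrite (nsrN nsr).
  have := nsrM nsr (z - y) c; have := nsrM nsr c (z - y).
  have := nsr_ge0 c; have := nsr_ge0 (z - y); nra.
- move=> sb; apply/subr0_eq/(@nsr_small _ 2) => e /yl[M /(_ M (leqnn M)) My].
  have sz := dyadic_star sb (dyadic_iter b M); set z := sqrt_iter b M in My sz.
  have -> : s y - y = (z - y) - s (z - y).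
    have -> : s (z - y) = z - s y.
      by apply: (addIr (s y)); rewrite -(nsr_starD nsr) !subrK.
    by rewrite opprB [RHS]addrC addrA subrK.
  apply: le_trans (nsrD nsr _ _) _; rewrite (nsrN nsr) (nsr_starN nsr).
  by lra.
Qed.

End SquareRoot.

(** * Injective representations are isometric *)

Section RealInnerProduct.
Context {R : realType} {H : hilbertType R}.
Implicit Types x y z : H.

(** Estimates are made over the ordered field [R]. Complex identities are recovered from the real
    part by replacing a vector with its multiple by i. *)
Definition rdot x y : R := complex.Re (hdot x y).

Lemma normE x : `|x| = (rnorm x)%:C.
Proof. by rewrite /rnorm RRe_real // normr_real. Qed.

Lemma rnorm_ge0 x : 0 <= rnorm x.
Proof. by rewrite -ler0c -normE. Qed.

Lemma rdotxx x : rdot x x = rnorm x ^+ 2.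
Proof. by rewrite /rdot hdot_norm normE -rmorphXn. Qed.

Lemma hdotC x y : hdot x y = (hdot y x)^*.
Proof. by rewrite hermC expr0 mul1r. Qed.

Lemma ReD (a b : R[i]) : complex.Re (a + b) = complex.Re a + complex.Re b.
Proof. exact: raddfD. Qed.

Lemma rdotC x y : rdot x y = rdot y x.
Proof. by rewrite /rdot hdotC; case: (hdot y x). Qed.

Lemma rdotDl x y z : rdot (x + y) z = rdot x z + rdot y z.
Proof. by rewrite /rdot linearDl ReD. Qed.

Lemma rdotDr x y z : rdot z (x + y) = rdot z x + rdot z y.
Proof. by rewrite rdotC rdotDl !(rdotC z). Qed.

Lemma rdotZl (t : R) x y : rdot (t%:C *: x) y = t * rdot x y.
Proof. by rewrite /rdot linearZl_LR /=; case: (hdot x y) => a b /=; ring. Qed.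

Lemma rdotZr (t : R) x y : rdot y (t%:C *: x) = t * rdot y x.
Proof. by rewrite rdotC rdotZl rdotC. Qed.

Lemma rdotNl x y : rdot (- x) y = - rdot x y.
Proof. by rewrite /rdot linearNl raddfN. Qed.

Lemma rdotNr x y : rdot y (- x) = - rdot y x.
Proof. by rewrite rdotC rdotNl rdotC. Qed.

Lemma rdot0l x : rdot 0 x = 0.
Proof. by rewrite /rdot linear0l. Qed.

Lemma rdot_suml I r (P : pred I) (F : I -> H) y :
  rdot (\sum_(i <- r | P i) F i) y = \sum_(i <- r | P i) rdot (F i) y.
Proof. by apply: (big_morph (fun x => rdot x y)) => [a b|]; [exact: rdotDl|exact: rdot0l]. Qed.

Lemma rdot_sumr I r (P : pred I) (F : I -> H) y :
  rdot y (\sum_(i <- r | P i) F i) = \sum_(i <- r | P i) rdot y (F i).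
Proof. by rewrite rdotC rdot_suml; apply: eq_bigr => i _; rewrite rdotC. Qed.

Lemma rdot_le_half x y : 2 * rdot x y <= rnorm x ^+ 2 + rnorm y ^+ 2.
Proof.
have := sqr_ge0 (rnorm (x - y)).
by rewrite -(rdotxx (x - y)) rdotDl !rdotDr !rdotNl !rdotNr opprK !rdotxx (rdotC y x); lra.
Qed.

Lemma rnorm0_eq0 x : rnorm x = 0 -> x = 0.
Proof. by move=> x0; apply/eqP; rewrite -normr_eq0 normE x0. Qed.

Lemma rnorm0 : rnorm (0 : H) = 0.
Proof. by rewrite /rnorm normr0. Qed.

Lemma rnormZ (c : R[i]) x : rnorm (c *: x) = rnorm c * rnorm x.
Proof. by rewrite /rnorm normrZ [`|x|]normE; case: `|c| => a b /=; ring. Qed.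

Lemma rnormN x : rnorm (- x) = rnorm x.
Proof. by rewrite /rnorm normrN. Qed.

Lemma ler_rnormD x y : rnorm (x + y) <= rnorm x + rnorm y.
Proof. by rewrite -lecR rmorphD /= -!normE ler_normD. Qed.

End RealInnerProduct.

Lemma rnormC (R : realType) (t : R) : 0 <= t -> rnorm t%:C = t.
Proof. by move=> t0; rewrite /rnorm ger0_norm // ler0c. Qed.

Section CStar.
Context {R : realType} {A : cstarType R}.
Implicit Types a b p k : A.

Lemma cnorm0 : cnorm (0 : A) = 0.
Proof. by rewrite -(scale0r (0 : A)) cnormZ /rnorm normr0 mul0r. Qed.

Lemma cnormN a : cnorm (- a) = cnorm a.
Proof. by rewrite -scaleN1r cnormZ /rnorm normrN1 mul1r. Qed.

Lemma cnorm_ge0 a : 0 <= cnorm a.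
Proof.
by have := cnormD a (- a); rewrite subrr cnorm0 cnormN; lra.
Qed.

Lemma cnorm_star a : cnorm (star a) = cnorm a.
Proof.
have le_star b : cnorm b <= cnorm (star b).
  have := cstar_norm b; have := cnormM (star b) b; rewrite expr2.
  have := cnorm_ge0 b; have := cnorm_ge0 (star b).
  rewrite le_eqVlt => /predU1P[<-|s0]; last by nra.
  move=> b0; rewrite mul0r => bb0 eqbb; rewrite eqbb in bb0.
  by rewrite leNgt; apply/negP => bgt; move: bb0; rewrite leNgt mulr_gt0.
by apply/eqP; rewrite eq_le le_star andbT -{2}[a]starK le_star.
Qed.

Lemma star1 : star (1 : A) = 1.
Proof. by rewrite -[LHS]mulr1 -{2}[1]starK -starM mulr1 starK. Qed.

Lemma starN a : star (- a) = - star a.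
Proof.
by apply: (addIr (star a)); rewrite -starD !addNr; apply: (addIr (star 0)); rewrite -starD !add0r.
Qed.

Lemma starB a b : star (a - b) = star a - star b.
Proof. by rewrite starD starN. Qed.

Lemma starRZ (t : R) a : star (t%:C *: a) = t%:C *: star a.
Proof. by rewrite starZ; congr (_ *: _); exact: conjc_real. Qed.

Lemma cnorm1 : cnorm (1 : A) <= 1.
Proof.
have := cstar_norm (1 : A); rewrite star1 mulr1 expr2 => e1.
by have := cnorm_ge0 (1 : A); nra.
Qed.

Lemma cnormX_le1 a i : cnorm a <= 1 -> cnorm (a ^+ i) <= 1.
Proof.
move=> a1; elim: i => [|i IH]; first exact: cnorm1.
rewrite exprS; apply: le_trans (cnormM _ _) _.
by rewrite mulr_ile1 ?cnorm_ge0.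
Qed.

Definition cstar_half : A := (2^-1%:C)%:A.

Lemma cstar_nsr : normed_star_ring (@cnorm R A) (@star R A) cstar_half.
Proof.
have c2 : 2^-1%:C + 2^-1%:C = 1 :> R[i] by rewrite -rmorphD /=; congr (_%:C); field.
split.
- exact: cnormD.
- exact: cnormN.
- exact: cnormM.
- exact: cnorm0.
- exact: cnorm_eq0.
- exact: cnorm_complete.
- exact: cnorm_star.
- exact: starD.
- exact: starM.
- exact: star1.
- by rewrite /cstar_half starRZ star1.
- by rewrite /cstar_half -scalerDl c2 scale1r.
- by move=> x; rewrite /cstar_half mulr_algl mulr_algr.
- by move=> x; rewrite /cstar_half mulr_algl cnormZ rnormC ?invr_ge0 // mulrC.
Qed.

(* [p + i k] is unitary. *)
Lemma cnorm_unitary_part p k : star p = p -> star k = k -> p * k = k * p ->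
  p * p + k * k = 1 -> cnorm p <= 1.
Proof.
move=> sp sk pk pk1; pose u := p + 'i *: k.
have su : star u = p - 'i *: k.
  by rewrite /u starD sp starZ sk conjCi scaleNr.
have uu : star u * u = 1.
  have ii : 'i * 'i = -1 :> R[i] by rewrite -expr2 sqrCi.
  rewrite su /u mulrBl !mulrDr -!scalerAl -!scalerAr scalerA ii scaleN1r.
  by rewrite pk opprD opprK addrA addrK.
have u1 : cnorm u <= 1.
  have := cstar_norm u; rewrite uu => e; have := cnorm1.
  by rewrite e expr_le1 ?cnorm_ge0.
have -> : p = cstar_half * (u + star u).
  rewrite su /u addrACA subrr addr0 mulrDr -mulrDl.
  by rewrite (nsr_half cstar_nsr) mul1r.
apply: le_trans (nsr_halfN cstar_nsr _) _.
by have := cnormD u (star u); rewrite cnorm_star; lra.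
Qed.

End CStar.

Section Representation.
Context {R : realType} {A : cstarType R} {E : hilbertType R} (rho : A -> E -> E).
Hypothesis rep : star_rep rho.

Lemma repD a b x : rho (a + b) x = rho a x + rho b x.
Proof. by rewrite -[a]scale1r (rep_linear rep) !scale1r. Qed.

Lemma rep0 x : rho 0 x = 0.
Proof. by apply: (addIr (rho 0 x)); rewrite -repD !add0r. Qed.

Lemma repZ c a x : rho (c *: a) x = c *: rho a x.
Proof. by rewrite -[c *: a]addr0 (rep_linear rep) rep0 addr0. Qed.

Lemma repN a x : rho (- a) x = - rho a x.
Proof. by rewrite -scaleN1r repZ scaleN1r. Qed.

Lemma repB a b x : rho (a - b) x = rho a x - rho b x.
Proof. by rewrite repD repN. Qed.

Lemma rep_suml I r (P : pred I) (F : I -> A) x :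
  rho (\sum_(i <- r | P i) F i) x = \sum_(i <- r | P i) rho (F i) x.
Proof. by apply: (big_morph (fun a => rho a x)) => [a b|]; [exact: repD|exact: rep0]. Qed.

Lemma repvP c a x y : rho a (c *: x + y) = c *: rho a x + rho a y.
Proof. by have [lin _] := rep_bounded rep a; apply: lin. Qed.

Lemma repvD a x y : rho a (x + y) = rho a x + rho a y.
Proof. by rewrite -[x]scale1r repvP !scale1r. Qed.

Lemma repv0 a : rho a 0 = 0.
Proof. by apply: (addIr (rho a 0)); rewrite -repvD !add0r. Qed.

Lemma repvZ c a x : rho a (c *: x) = c *: rho a x.
Proof. by rewrite -[c *: x]addr0 repvP repv0 addr0. Qed.

Lemma repv_sum I r (P : pred I) (F : I -> E) a :
  rho a (\sum_(i <- r | P i) F i) = \sum_(i <- r | P i) rho a (F i).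
Proof. by apply: (big_morph (rho a)) => [x y|]; [exact: repvD|exact: repv0]. Qed.

Lemma rep_rdot a x y : rdot (rho a x) y = rdot x (rho (star a) y).
Proof. by rewrite /rdot (rep_star rep). Qed.

Lemma rep_sqr a x : rnorm (rho a x) ^+ 2 = rdot (rho (star a * a) x) x.
Proof. by rewrite (rep_mul rep) -rdotxx rep_rdot rdotC. Qed.

(** With 1 - a^* a = (1 - y)^2 and [1 - y] selfadjoint, the difference of the squared norms of [x]
    and [rho a x] is the squared norm of [rho (1 - y) x]. *)
Lemma rep_contractive a x : cnorm a <= 1 -> rnorm (rho a x) <= rnorm x.
Proof.
move=> a1.
have aa1 : cnorm (star a * a) <= 1 by rewrite cstar_norm expr_le1 ?cnorm_ge0.
have [y [y1 _ _ sy]] := sqrt_one_minus cstar_nsr (fun k => cnormX_le1 k aa1).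
have saa : star (star a * a) = star a * a by rewrite starM starK.
have sq : star (1 - y) = 1 - y by rewrite starB star1 sy.
have := rep_sqr (1 - y) x; rewrite sq -expr2 y1 (repB 1 (star a * a)) rdotDl rdotNl -rep_sqr.
rewrite (rep_unit rep) rdotxx => e.
rewrite -(@ler_pXn2r _ 2) ?nnegrE ?rnorm_ge0 //.
by have := sqr_ge0 (rnorm (rho (1 - y) x)); lra.
Qed.

Hypothesis inj : injective rho.

(* Put [1 - b^2 = M k] and let [g = |k|]. Then [rho g] and [rho k] are positive
   with the same square, so [g = k] by injectivity; as [g] is a square [q^2],
   [b + i sqrt M q] is unitary. *)
Lemma rep_isometry_sa b : star b = b -> (forall x, rnorm (rho b x) <= rnorm x) ->
  cnorm b <= 1.
Proof.
move=> sb b1; pose h := 1 - b * b; pose M := cnorm h + 1.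
have M0 : 0 < M by rewrite /M; have := cnorm_ge0 h; lra.
have iM0 : 0 <= M^-1 by rewrite invr_ge0 ltW.
pose k := (M^-1)%:C *: h.
have sh : star h = h by rewrite /h starB star1 starM sb.
have sk : star k = k by rewrite /k starRZ sh.
have k1 : cnorm k <= 1.
  rewrite /k cnormZ rnormC // mulrC ler_pdivrMr // mul1r /M; lra.
have bk : b * k = k * b.
  by rewrite /k -scalerAl -scalerAr /h mulrBl mulrBr mulr1 mul1r mulrA.
have k2 i : cnorm ((k ^+ 2) ^+ i) <= 1.
  by do 2 apply: cnormX_le1.
(* [p] is the square root of 1 - k^2. Its norm is at most 1 because [p] is the real part of the
   unitary p + i k, and this makes the next square root possible. *)
have [y0 [p2 _ com0 sy0]] := sqrt_one_minus cstar_nsr k2.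
set p := 1 - y0 in p2.
have sp : star p = p by rewrite /p starB star1 sy0 // expr2 starM sk.
have comp c : c * k = k * c -> c * p = p * c.
  move=> ck; rewrite /p mulrBl mulrBr mul1r mulr1 com0 //.
  by apply: commrX.
have p1 : cnorm p <= 1.
  apply: (@cnorm_unitary_part _ _ p k) => //; first by rewrite comp.
  by rewrite -!expr2 p2 subrK.
have p2k i : cnorm ((p ^+ 2) ^+ i) <= 1 by do 2 apply: cnormX_le1.
(* [g] is the square root of 1 - p^2 = k^2. The bound on [y1] then gives a square root [q] of g = 1
   - y1, which shows that [rho g] is positive. *)
have [y1 [g2 y1n com1 sy1]] := sqrt_one_minus cstar_nsr p2k.
set g := 1 - y1 in g2.
have y1k i : cnorm (y1 ^+ i) <= 1 by apply: cnormX_le1.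
have [y2 [q2 _ com2 sy2]] := sqrt_one_minus cstar_nsr y1k.
set q := 1 - y2 in q2.
have sy1' : star y1 = y1 by apply: sy1; rewrite expr2 starM sp.
have sg : star g = g by rewrite /g starB star1 sy1'.
have sq : star q = q by rewrite /q starB star1 sy2.
have coy1 c : c * k = k * c -> c * y1 = y1 * c.
  by move=> ck; apply: com1; apply: commrX; apply: comp.
have cog c : c * k = k * c -> c * g = g * c.
  by move=> ck; rewrite /g mulrBl mulrBr mul1r mulr1 coy1.
have coq c : c * k = k * c -> c * q = q * c.
  by move=> ck; rewrite /q mulrBl mulrBr mul1r mulr1 com2 // coy1.
pose n := g - k.
have gk2 : g ^+ 2 = k ^+ 2 by rewrite g2 p2 opprB addrC subrK.
have gkn : (g + k) * n = 0.
  rewrite /n mulrBr !(mulrDl g k) -(expr2 g) -(expr2 k) gk2 (cog k) //.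
  by rewrite [k ^+ 2 + _]addrC subrr.
have sn : star n = n by rewrite /n starB sg sk.
(* On the range of [rho n] the positive operators [rho g] and [rho k] add up to zero, so both vanish
   there. Hence [rho n] squares to zero, and being selfadjoint it is zero. Positivity of [rho k] is
   the contractivity of [rho b]. *)
have n0 : n = 0.
  apply: inj; apply/funext => x; rewrite rep0; set w := rho n x.
  have gkw : rho g w + rho k w = 0 by rewrite -repD -(rep_mul rep) gkn rep0.
  have gw : rdot (rho g w) w = rnorm (rho q w) ^+ 2.
    by rewrite rep_sqr sq -expr2 q2.
  have kw : 0 <= rdot (rho k w) w.
    rewrite /k repZ rdotZl mulr_ge0 // /h repB (rep_unit rep).
    rewrite rdotDl rdotNl rdotxx -{1}sb -rep_sqr subr_ge0.
    by rewrite ler_pXn2r ?nnegrE ?rnorm_ge0.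
  have qw : rho q w = 0.
    apply/rnorm0_eq0/eqP; rewrite -sqrf_eq0; apply/eqP.
    have := congr1 (fun z => rdot z w) gkw; rewrite rdotDl rdot0l gw.
    by have := sqr_ge0 (rnorm (rho q w)); lra.
  have gw0 : rho g w = 0 by rewrite /g -q2 expr2 (rep_mul rep) qw repv0.
  have kw0 : rho k w = 0 by rewrite -gkw gw0 add0r.
  have nw : rho n w = 0 by rewrite /n repB gw0 kw0 subrr.
  apply/rnorm0_eq0/eqP; rewrite -sqrf_eq0 rep_sqr sn (rep_mul rep) nw rdot0l.
  exact: eqxx.
have kq : k = q ^+ 2 by rewrite q2; apply/esym/subr0_eq.
apply: (@cnorm_unitary_part _ _ b ((Num.sqrt M)%:C *: q)) => //.
- by rewrite starRZ sq.
- by rewrite -scalerAl -scalerAr coq.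
- have sM : Num.sqrt M * Num.sqrt M = M by rewrite -expr2 sqr_sqrtr // ltW.
  rewrite -scalerAl -scalerAr scalerA -rmorphM /= sM.
  rewrite -(expr2 q) -kq /k scalerA -rmorphM /= divff ?gt_eqF // scale1r /h.
  by rewrite addrC subrK.
Qed.

(** The C*-identity reduces the claim to the selfadjoint element a^* a, once [rho (star a)] is also
    known to be contractive. *)
Lemma rep_isometry a : (forall x, rnorm (rho a x) <= rnorm x) -> cnorm a <= 1.
Proof.
move=> a1; rewrite -(@expr_le1 _ 2) ?cnorm_ge0 // -cstar_norm.
apply: rep_isometry_sa; first by rewrite starM starK.
have as1 y : rnorm (rho (star a) y) <= rnorm y.
  set z := rho (star a) y; rewrite -(@ler_pXn2r _ 2) ?nnegrE ?rnorm_ge0 //.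
  have h1 : rnorm z ^+ 2 = rdot (rho a z) y by rewrite rep_rdot rdotxx.
  have h2 : rnorm (rho a z) ^+ 2 <= rnorm z ^+ 2.
    by rewrite ler_pXn2r ?nnegrE ?rnorm_ge0.
  (* From 2 |z|^2 = 2 <rho a z, y> <= |rho a z|^2 + |y|^2 <= |z|^2 + |y|^2, no division by |z| is
     required. *)
  by have := rdot_le_half (rho a z) y; lra.
by move=> x; rewrite (rep_mul rep); exact: le_trans (as1 _) (a1 _).
Qed.

End Representation.

(** * Contractive matrices over a C*-algebra *)

Section Columns.
Context {R : realType} {H : hilbertType R} {n : nat}.
Implicit Types x y z : 'cV[H]_n.

Definition cdot x y : R := \sum_i rdot (x i 0) (y i 0).
Definition csq x : R := \sum_i rnorm (x i 0) ^+ 2.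

Lemma cdotxx x : cdot x x = csq x.
Proof. by apply: eq_bigr => i _; rewrite rdotxx. Qed.

Lemma cdotE x y : cdot x y = complex.Re (col_dot x y).
Proof. by rewrite /col_dot raddf_sum. Qed.

Lemma csq_ge0 x : 0 <= csq x.
Proof. by apply: sumr_ge0 => i _; apply: sqr_ge0. Qed.

Lemma csq_entry x i : rnorm (x i 0) ^+ 2 <= csq x.
Proof.
by rewrite /csq (bigD1 i) //= lerDl; apply: sumr_ge0 => j _; apply: sqr_ge0.
Qed.

Lemma csq_eq0 x : csq x = 0 -> x = 0.
Proof.
move=> x0; apply/matrixP => i j; rewrite mxE ord1; apply/rnorm0_eq0/eqP.
by rewrite -sqrf_eq0 eq_le sqr_ge0 andbT -x0 csq_entry.
Qed.

Lemma csq0 : csq 0 = 0.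
Proof. by rewrite /csq big1 // => i _; rewrite mxE rnorm0 expr0n. Qed.

Lemma col_norm_sq x : col_norm (@rnorm R H) x ^+ 2 = csq x.
Proof. by rewrite sqr_sqrtr ?csq_ge0. Qed.

Lemma col_norm_ge0 x : 0 <= col_norm (@rnorm R H) x.
Proof. exact: sqrtr_ge0. Qed.

Lemma cdotC x y : cdot x y = cdot y x.
Proof. by apply: eq_bigr => i _; apply: rdotC. Qed.

Lemma cdotDl x y z : cdot (x + y) z = cdot x z + cdot y z.
Proof. by rewrite -big_split; apply: eq_bigr => i _; rewrite mxE rdotDl. Qed.

Lemma cdotDr x y z : cdot z (x + y) = cdot z x + cdot z y.
Proof. by rewrite cdotC cdotDl !(cdotC z). Qed.

Lemma cdotNl x y : cdot (- x) y = - cdot x y.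
Proof. by rewrite -sumrN; apply: eq_bigr => i _; rewrite mxE rdotNl. Qed.

Lemma cdotNr x y : cdot y (- x) = - cdot y x.
Proof. by rewrite cdotC cdotNl cdotC. Qed.

Lemma cdot0l x : cdot 0 x = 0.
Proof. by rewrite -(subrr x) cdotDl cdotNl subrr. Qed.

Lemma cdot0r x : cdot x 0 = 0.
Proof. by rewrite cdotC cdot0l. Qed.

Definition scale_col (c : R[i]) x : 'cV[H]_n := map_mx ( *:%R c) x.

Lemma cdotZl (t : R) x y : cdot (scale_col t%:C x) y = t * cdot x y.
Proof. by rewrite mulr_sumr; apply: eq_bigr => i _; rewrite mxE rdotZl. Qed.

Lemma cdotZr (t : R) x y : cdot y (scale_col t%:C x) = t * cdot y x.
Proof. by rewrite cdotC cdotZl cdotC. Qed.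

Lemma csqZ (c : R[i]) x : csq (scale_col c x) = rnorm c ^+ 2 * csq x.
Proof. by rewrite mulr_sumr; apply: eq_bigr => i _; rewrite mxE rnormZ exprMn. Qed.

Lemma csqD x y : csq (x + y) = csq x + 2 * cdot x y + csq y.
Proof. by rewrite -!cdotxx cdotDl !cdotDr (cdotC y x); ring. Qed.

Lemma cdot_le_half x y : 2 * cdot x y <= csq x + csq y.
Proof.
by have := csq_ge0 (x - y); rewrite csqD cdotNr -[csq (- y)]cdotxx cdotNl cdotNr cdotxx; lra.
Qed.

Lemma discriminant_le0 (a b c : R) : 0 <= c ->
  (forall t, 0 <= a + 2 * t * b + t ^+ 2 * c) -> b ^+ 2 <= a * c.
Proof.
rewrite le_eqVlt => /predU1P[<-|c0] pos.
  have [->|b0] := eqVneq b 0; first by rewrite mulr0 expr0n.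
  (* For c = 0 the form is affine in t, and at this t it would equal -1. *)
  have := pos (- (a + 1) / (2 * b)); rewrite mulr0 addr0.
  have -> : 2 * (- (a + 1) / (2 * b)) * b = - (a + 1) by field.
  by lra.
have := pos (- b / c).
have -> : a + 2 * (- b / c) * b + (- b / c) ^+ 2 * c = (a * c - b ^+ 2) / c.
  by field; rewrite gt_eqF.
by rewrite pmulr_lge0 ?invr_gt0 // subr_ge0.
Qed.

Lemma cdot_sqr_le x y : cdot x y ^+ 2 <= csq x * csq y.
Proof.
apply: discriminant_le0 (csq_ge0 y) _ => t.
have := csq_ge0 (x + scale_col t%:C y).
by rewrite csqD cdotZr -[csq (scale_col _ _)]cdotxx cdotZl cdotZr cdotxx expr2 !mulrA.
Qed.

End Columns.

(** * Matrices over the algebra acting through the representation *)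

Section RepMatrix.
Context {R : realType} {A : cstarType R} {E : hilbertType R} (rho : A -> E -> E).
Hypothesis rep : star_rep rho.

(** Norm at most 1 in the matrix norm induced by [rho], stated for all vectors and with squared
    norms so that neither a supremum nor a rescaling is involved. *)
Definition contractive p q (V : 'M[A]_(p, q)) : Prop :=
  forall x : 'cV[E]_q, csq (mx_act rho V x) <= csq x.

Lemma rep_mxM p q r (V : 'M[A]_(p, q)) (W : 'M[A]_(q, r)) x :
  mx_act rho (V *m W) x = mx_act rho V (mx_act rho W x).
Proof.
apply/matrixP => i j; rewrite !mxE.
under eq_bigr => k _ do rewrite mxE (rep_suml rep).
rewrite exchange_big /=; apply: eq_bigr => k _; rewrite mxE (repv_sum rep).
by apply: eq_bigr => l _; rewrite (rep_mul rep).
Qed.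

Lemma rep_mx1 q (x : 'cV[E]_q) : mx_act rho 1%:M x = x.
Proof.
apply/matrixP => i j; rewrite mxE (bigD1 i) //= big1 ?addr0.
  by rewrite mxE eqxx (rep_unit rep) ord1.
by move=> k ki; rewrite mxE eq_sym (negPf ki) (rep0 rep).
Qed.

Lemma rep_mx_cdot p q (V : 'M[A]_(p, q)) x y :
  cdot (mx_act rho V x) y = cdot x (mx_act rho (star_mx V) y).
Proof.
rewrite /cdot.
under eq_bigr => i _ do rewrite mxE rdot_suml.
rewrite exchange_big /=; apply: eq_bigr => j _; rewrite mxE rdot_sumr.
by apply: eq_bigr => i _; rewrite mxE (rep_rdot rep).
Qed.

Lemma star_mxK p q : cancel (@star_mx R A p q) (@star_mx R A q p).
Proof. by move=> V; apply/matrixP => i j; rewrite !mxE starK. Qed.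

Lemma star0A : star (0 : A) = 0.
Proof. by apply: (addIr (star (0 : A))); rewrite -starD !add0r. Qed.

Lemma star_sum I (r : seq I) (P : pred I) (F : I -> A) :
  star (\sum_(i <- r | P i) F i) = \sum_(i <- r | P i) star (F i).
Proof. by apply: (big_morph (@star R A)) => [a b|]; [exact: starD|exact: star0A]. Qed.

Lemma star_mxM p q r (V : 'M[A]_(p, q)) (W : 'M[A]_(q, r)) :
  star_mx (V *m W) = star_mx W *m star_mx V.
Proof.
apply/matrixP => i j; rewrite !mxE star_sum; apply: eq_bigr => k _.
by rewrite !mxE starM.
Qed.

Lemma star_mxD p q (V W : 'M[A]_(p, q)) : star_mx (V + W) = star_mx V + star_mx W.
Proof. by apply/matrixP => i j; rewrite !mxE starD. Qed.

Lemma star_mx1 q : star_mx (1%:M : 'M[A]_q) = 1%:M.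
Proof.
apply/matrixP => i j; rewrite !mxE eq_sym.
by case: eqP => _; rewrite ?star1 ?star0A.
Qed.

Lemma contractive_star p q (V : 'M[A]_(p, q)) :
  contractive V -> contractive (star_mx V).
Proof.
move=> cV y; set z := mx_act _ _ y.
have h1 : csq z = cdot (mx_act rho V z) y by rewrite rep_mx_cdot cdotxx.
by have := cdot_le_half (mx_act rho V z) y; have := cV z; lra.
Qed.

Lemma contractiveM p q r (V : 'M[A]_(p, q)) (W : 'M[A]_(q, r)) :
  contractive V -> contractive W -> contractive (V *m W).
Proof. by move=> cV cW x; rewrite rep_mxM; apply: le_trans (cV _) (cW _). Qed.

Lemma contractive1 q : contractive (1%:M : 'M[A]_q).
Proof. by move=> x; rewrite rep_mx1. Qed.

Hypothesis inj : injective rho.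

(** Feeding a vector into slot [j] and reading slot [i] shows that [rho (V i j)] is contractive; the
    isometry property turns this into a bound on the norm of [A] itself. *)
Lemma contractive_entry p q (V : 'M[A]_(p, q)) i j :
  contractive V -> cnorm (V i j) <= 1.
Proof.
move=> cV; apply: (rep_isometry rep inj) => x.
pose d : 'cV[E]_q := \col_k (if k == j then x else 0).
have dx : csq d = rnorm x ^+ 2.
  rewrite /csq (bigD1 j) //= mxE eqxx big1 ?addr0 // => k /negPf kj.
  by rewrite mxE kj rnorm0 expr0n.
rewrite -(@ler_pXn2r _ 2) ?nnegrE ?rnorm_ge0 // -dx.
apply: le_trans (cV d); apply: le_trans (csq_entry _ i).
rewrite mxE (bigD1 j) //= mxE eqxx big1 ?addr0 // => k /negPf kj.
by rewrite mxE kj (repv0 rep).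
Qed.

(** This norm inherits completeness, submultiplicativity and invariance under the involution
    directly from the entries. *)
Definition entry_norm q (P : 'M[A]_q) : R := \sum_i \sum_j cnorm (P i j).

Lemma entry_norm_ge p (P : 'M[A]_p) i j : cnorm (P i j) <= entry_norm P.
Proof.
rewrite /entry_norm (bigD1 i) //= (bigD1 j) //= -addrA lerDl addr_ge0 //.
  by apply: sumr_ge0 => k _; apply: cnorm_ge0.
by apply: sumr_ge0 => k _; apply: sumr_ge0 => l _; apply: cnorm_ge0.
Qed.

Lemma entry_norm_complete q (u : nat -> 'M[A]_q) :
  (forall e : R, 0 < e -> exists M : nat, forall m n : nat,
     (M <= m)%N -> (M <= n)%N -> entry_norm (u m - u n) < e) ->
  exists l, forall e : R, 0 < e -> exists M : nat, forall n : nat,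
    (M <= n)%N -> entry_norm (u n - l) < e.
Proof.
move=> cu.
have entry (ij : 'I_q * 'I_q) : exists l : A, forall e : R, 0 < e ->
    exists M : nat, forall n : nat, (M <= n)%N -> cnorm (u n ij.1 ij.2 - l) < e.
  apply: cnorm_complete => e /cu[M uM]; exists M => m n Mm Mn.
  apply: le_lt_trans (uM _ _ Mm Mn).
  by have := entry_norm_ge (u m - u n) ij.1 ij.2; rewrite !mxE.
have [l ul] := choice entry.
exists (\matrix_(i, j) l (i, j)) => e e0.
(* The summand 1 keeps the denominator positive when q = 0 and makes q^2 d < e strict. *)
pose d := e / ((q * q)%:R + 1).
have q0 : 0 <= (q * q)%:R :> R by rewrite ler0n.
have d0 : 0 < d by rewrite divr_gt0 //; lra.
have [M uM] := choice (fun ij => ul ij d d0).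
exists (\max_ij M ij) => n Mn.
have le_d i j : cnorm ((u n - \matrix_(i, j) l (i, j)) i j) <= d.
  rewrite !mxE; apply/ltW/(uM (i, j))/(leq_trans _ Mn).
  exact: (leq_bigmax (i, j)).
apply: (@le_lt_trans _ _ ((q * q)%:R * d)).
  apply: (@le_trans _ _ (\sum_(i < q) \sum_(j < q) d)).
    by apply: ler_sum => i _; apply: ler_sum => j _.
  by rewrite !sumr_const !card_ord -mulrnA mulr_natl.
rewrite /d mulrCA gtr_pMr // ltr_pdivrMr ?mul1r; lra.
Qed.

Lemma entry_nsr q : normed_star_ring (@entry_norm q) (@star_mx R A q q) ((@cstar_half R A)%:M).
Proof.
have nsA := @cstar_nsr R A.
have halfE (x : 'M[A]_q) i j : (cstar_half%:M *m x) i j = cstar_half * x i j.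
  by rewrite mul_scalar_mx mxE.
split.
- move=> x y; rewrite /entry_norm -big_split; apply: ler_sum => i _.
  by rewrite -big_split; apply: ler_sum => j _; rewrite mxE; apply: cnormD.
- by move=> x; apply: eq_bigr => i _; apply: eq_bigr => j _; rewrite mxE cnormN.
- move=> x y; rewrite /entry_norm mulr_suml; apply: ler_sum => i _.
  apply: (@le_trans _ _ (\sum_j \sum_k cnorm (x i k) * cnorm (y k j))).
    apply: ler_sum => j _; rewrite mxE.
    apply: (@le_trans _ _ (\sum_k cnorm (x i k * y k j))).
      apply: (big_ind2 (fun a t => cnorm a <= t)) => //; first by rewrite cnorm0.
      by move=> a s b t ha hb; apply: le_trans (cnormD _ _) (lerD ha hb).
    by apply: ler_sum => k _; apply: cnormM.
  rewrite exchange_big /= mulr_suml; apply: ler_sum => k _.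
  rewrite -mulr_sumr ler_wpM2l ?cnorm_ge0 // [leRHS](bigD1 k) //= lerDl.
  by apply: sumr_ge0 => l _; apply: sumr_ge0 => j _; apply: cnorm_ge0.
- by rewrite /entry_norm big1 // => i _; rewrite big1 // => j _; rewrite mxE cnorm0.
- move=> x x0; apply/matrixP => i j; rewrite mxE; apply: cnorm_eq0; apply/eqP.
  by rewrite eq_le cnorm_ge0 andbT -x0 entry_norm_ge.
- exact: entry_norm_complete.
- move=> x; rewrite /entry_norm exchange_big; apply: eq_bigr => i _.
  by apply: eq_bigr => j _; rewrite mxE cnorm_star.
- exact: star_mxD.
- exact: star_mxM.
- exact: star_mx1.
- apply/matrixP => i j; rewrite !mxE eq_sym.
  by case: eqP => _; rewrite ?mulr1n ?mulr0n ?star0A // (nsr_starh nsA).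
- by rewrite -raddfD /= (nsr_half nsA).
- move=> x; apply/matrixP => i j; rewrite [LHS]halfE !mxE (bigD1 j) //= big1.
    by rewrite addr0 mxE eqxx mulr1n (nsr_halfC nsA).
  by move=> k kj; rewrite mxE (negPf kj) mulr0n mulr0.
- move=> x; rewrite /entry_norm mulr_suml; apply: ler_sum => i _.
  by rewrite mulr_suml; apply: ler_sum => j _; rewrite halfE (nsr_halfN nsA).
Qed.

(* The powers of [V^* V] are contractions, hence bounded since [rho] is
   isometric, so that [V^* V] has a square-root series. *)
Lemma pos_one_minus p q (V : 'M[A]_(p, q)) : contractive V ->
  pos_mx (1%:M - star_mx V *m V).
Proof.
move=> cV; set B := star_mx V *m V.
have cB : contractive B by apply: contractiveM => //; apply: contractive_star.
have cBk k : contractive (B ^+ k).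
  elim: k => [|k IH]; first exact: contractive1.
  by rewrite exprS; apply: contractiveM.
have NB k : entry_norm (B ^+ k) <= \sum_(i < q) \sum_(j < q) 1.
  by apply: ler_sum => i _; apply: ler_sum => j _; apply: contractive_entry.
have [y [y2 _ _ sy]] := sqrt_one_minus (entry_nsr q) NB.
have sB : star_mx B = B by rewrite /B star_mxM star_mxK.
exists (1 - y); have -> : star_mx (1 - y) = 1 - y.
  apply: (addIr (star_mx y)); rewrite -star_mxD subrK sy // subrK.
  exact: star_mx1.
exact: esym y2.
Qed.

End RepMatrix.

(** * One-sided and iterated direct sums *)

Section DirectSums.
Context {S : Type} (s0 : S) (Omega : forall n, set 'M[S]_n).
Arguments Omega : clear implicits.
Hypothesis Omega_nc : nc_set s0 Omega.

(** Isolating this property makes it stable under exchanging the arguments and transposing, so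
    statements about columns follow from those about rows. *)
Definition dsum_compatible {T U : Type}
    (K : forall n m, 'M[S]_n -> 'M[S]_m -> 'M[T]_(n, m) -> 'M[U]_(n, m)) : Prop :=
  forall n n' m m' Z Z' W W',
    Omega n Z -> Omega n' Z' -> Omega m W -> Omega m' W' ->
    forall P11 P12 P21 P22,
      K _ _ (dsum s0 Z Z') (dsum s0 W W') (block_mx P11 P12 P21 P22) =
      block_mx (K _ _ Z W P11) (K _ _ Z W' P12) (K _ _ Z' W P21) (K _ _ Z' W' P22).

Lemma dsum_compatible_tr {T U : Type}
    (K : forall n m, 'M[S]_n -> 'M[S]_m -> 'M[T]_(n, m) -> 'M[U]_(n, m)) :
  dsum_compatible K ->
  dsum_compatible (fun n m Z W P => (K m n W Z P^T)^T).
Proof.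
move=> cK n n' m m' Z Z' W W' oZ oZ' oW oW' P11 P12 P21 P22.
by rewrite tr_block_mx cK // tr_block_mx.
Qed.

Lemma dsumA n1 n2 n3 (Z1 : 'M[S]_n1) (Z2 : 'M[S]_n2) (Z3 : 'M[S]_n3) :
  dsum s0 Z1 (dsum s0 Z2 Z3) =
  castmx (esym (addnA n1 n2 n3), esym (addnA n1 n2 n3)) (dsum s0 (dsum s0 Z1 Z2) Z3).
Proof.
rewrite /dsum -(row_mx_const n1 n2 n3) -(col_mx_const n2 n3 n1) block_mxA.
by rewrite row_mx_const col_mx_const.
Qed.

(** [dsum_iter] ends with an empty block, which is not a point of [Omega]. The last summand is
    therefore freed by a cast and not by the rule for direct sums. *)
Lemma dsum_empty m (W : 'M[S]_m) (Z : 'M[S]_0) :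
  dsum s0 W Z = castmx (esym (addn0 m), esym (addn0 m)) W.
Proof.
apply/matrixP => i j; rewrite castmxE.
case: (split_ordP i) => [i' ->|[]//]; case: (split_ordP j) => [j' ->|[]//].
by rewrite block_mxEul; congr (W _ _); apply: val_inj.
Qed.

Lemma Omega_cast n n' (e : n = n') Z : Omega n Z -> Omega n' (castmx (e, e) Z).
Proof. by case: n' / e; rewrite castmx_id. Qed.

Lemma Omega_iter r m W : (0 < r)%N -> Omega m W -> Omega (r * m)%N (dsum_iter s0 r W).
Proof.
move=> + oW; elim: r => // -[|r] IH _.
  by have := Omega_cast (esym (addn0 m)) oW; rewrite -(dsum_empty W (const_mx s0)).
by apply: (proj2 Omega_nc) => //; apply: IH.
Qed.

Section Kernel.
Context {T U : Type}.
Variable K : forall n m, 'M[S]_n -> 'M[S]_m -> 'M[T]_(n, m) -> 'M[U]_(n, m).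
Hypothesis cK : dsum_compatible K.
Arguments K {n m}.

Lemma kernel_castK n n' m (e : n = n') (Z : 'M[S]_n) (W : 'M[S]_m) P :
  K (castmx (e, e) Z) W (castmx (e, erefl) P) = castmx (e, erefl) (K Z W P).
Proof. by case: n' / e; rewrite !castmx_id. Qed.

Lemma kernel_cast n n' m (e : n = n') (Z : 'M[S]_n) (W : 'M[S]_m) P :
  K (castmx (e, e) Z) W P =
  castmx (e, erefl) (K Z W (castmx (esym e, erefl) P)).
Proof. by case: n' / e P => P; rewrite !castmx_id. Qed.

(* Only direct sums in both arguments are given; one-sided ones come from
   comparing the two bracketings of a triple direct sum. *)
Lemma kernel_dsum_usubmx n n' m Z Z' W (P : 'M[T]_(n + n', m)) :
  Omega n Z -> Omega n' Z' -> Omega m W ->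
  K Z W (usubmx P) = usubmx (K (dsum s0 Z Z') W P).
Proof.
move=> oZ oZ' oW; have o2 := proj2 Omega_nc.
(* For the sum of [Z], [Z'], [Z], grouping the first two gives [K (dsum s0 Z Z') W P] as the upper
   left block, while grouping the last two gives [K Z W (usubmx P)]. Only these blocks are
   compared. *)
pose Q := block_mx P P (usubmx P) (usubmx P).
have := kernel_castK (esym (addnA n n' n)) (dsum s0 (dsum s0 Z Z') Z) (dsum s0 W W) Q.
rewrite -dsumA [in RHS]cK //; last exact: o2.
rewrite -[castmx _ Q]submxK cK //; last exact: o2.
move=> /matrixP eqK; apply/matrixP => i j.
have := eqK (lshift _ i) (lshift _ j); rewrite block_mxEul castmxE /=.
have -> : cast_ord (esym (esym (addnA n n' n))) (lshift (n' + n) i) = lshift n (lshift n' i).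
  exact: val_inj.
rewrite cast_ord_id block_mxEul mxE => <-; congr (K Z W _ i j).
apply/matrixP => k l; rewrite !mxE castmxE /=.
have -> : cast_ord (esym (esym (addnA n n' n))) (lshift (n' + n) k) = lshift n (lshift n' k).
  exact: val_inj.
by rewrite cast_ord_id block_mxEul.
Qed.

Lemma kernel_dsum_dsubmx n n' m Z Z' W (P : 'M[T]_(n + n', m)) :
  Omega n Z -> Omega n' Z' -> Omega m W ->
  K Z' W (dsubmx P) = dsubmx (K (dsum s0 Z Z') W P).
Proof.
move=> oZ oZ' oW; have o2 := proj2 Omega_nc.
pose Q := block_mx (dsubmx P) (dsubmx P) P P.
have := kernel_cast (esym (addnA n' n n')) (dsum s0 (dsum s0 Z' Z) Z') (dsum s0 W W) Q.
rewrite -dsumA cK //; last exact: o2.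
rewrite -[castmx _ Q]submxK cK //; last exact: o2.
move=> /matrixP eqK; apply/matrixP => i j.
have := eqK (rshift _ (rshift _ i)) (lshift _ j); rewrite block_mxEdl castmxE /=.
have -> : cast_ord (esym (esym (addnA n' n n'))) (rshift n' (rshift n i)) = rshift (n' + n) i.
  by apply: val_inj; rewrite /= addnA.
rewrite cast_ord_id block_mxEdl mxE => ->; congr (K Z' W _ i j).
apply/matrixP => k l; rewrite !mxE castmxE /=.
have -> : cast_ord (esym (esym (esym (addnA n' n n')))) (rshift (n' + n) k) = rshift n' (rshift n k).
  by apply: val_inj; rewrite /= addnA.
by rewrite cast_ord_id block_mxEdl.
Qed.

Definition tidx r m (k : 'I_r) (i : 'I_m) : 'I_(r * m) := mxtens_index (k, i).

Lemma tidx0 r m (i : 'I_m) : tidx (ord0 : 'I_r.+1) i = lshift (r * m) i.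
Proof. by apply: val_inj; rewrite /= mul0n. Qed.

Lemma tidxS r m (k : 'I_r) (i : 'I_m) : tidx (lift ord0 k) i = rshift m (tidx k i).
Proof. by apply: val_inj; rewrite /= /bump mulnDl mul1n addnA. Qed.

Lemma kernel_iter_rowsub r k m m' W W' (P : 'M[T]_(r * m, m')) :
  Omega m W -> Omega m' W' ->
  K W W' (rowsub (tidx k) P) = rowsub (tidx k) (K (dsum_iter s0 r W) W' P).
Proof.
move=> oW oW'; elim: r k P => [[]//|[_ k P|r IH k P]].
  (* A single copy still carries the empty block, so [K] is transported along the cast here; the
     induction proper starts with two copies. *)
  have -> : dsum_iter s0 1 W = castmx (esym (addn0 m), esym (addn0 m)) W.
    exact: dsum_empty.
  rewrite kernel_cast ord1; apply/matrixP => i j; rewrite mxE castmxE /=.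
  have -> : cast_ord (esym (esym (addn0 m))) (tidx (ord0 : 'I_1) i) = i.
    by apply: val_inj; rewrite /= mul0n.
  rewrite cast_ord_id; congr (K W W' _ i j); apply/matrixP => k' l.
  rewrite mxE castmxE cast_ord_id; congr (P _ _); apply: val_inj.
  by rewrite /= mul0n.
have oiW : Omega _ (dsum_iter s0 r.+1 W) by apply: Omega_iter.
have [->|k0] := eqVneq k ord0.
  have e (V : Type) (B : 'M[V]_(r.+2 * m, m')) :
      rowsub (tidx ord0) B = usubmx (B : 'M[V]_(m + r.+1 * m, m')).
    by apply/matrixP => i j; rewrite !mxE tidx0.
  by rewrite !e (kernel_dsum_usubmx _ oW oiW oW').
have [k' kk'] : exists k', k = lift ord0 k'.
  by case: (unliftP ord0 k) => [k' ->|/eqP]; [exists k'|rewrite (negPf k0)].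
have e (V : Type) (B : 'M[V]_(r.+2 * m, m')) :
    rowsub (tidx k) B = rowsub (tidx k') (dsubmx (B : 'M[V]_(m + r.+1 * m, m'))).
  by apply/matrixP => i j; rewrite !mxE kk' tidxS.
by rewrite !e IH (kernel_dsum_dsubmx _ oW oiW oW').
Qed.

End Kernel.

Lemma kernel_iter_mxsub {T U : Type}
    (K : forall n m, 'M[S]_n -> 'M[S]_m -> 'M[T]_(n, m) -> 'M[U]_(n, m)) r k l m W
    (P : 'M[T]_(r * m)) :
  dsum_compatible K -> Omega m W ->
  K _ _ W W (mxsub (tidx k) (tidx l) P) =
  mxsub (tidx k) (tidx l) (K _ _ (dsum_iter s0 r W) (dsum_iter s0 r W) P).
Proof.
move=> cK oW; have r0 : (0 < r)%N by apply: leq_trans (ltn_ord k).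
have oiW := Omega_iter r0 oW.
have -> : mxsub (tidx k) (tidx l) P = rowsub (tidx k) (colsub (tidx l) P).
  by apply/matrixP => i j; rewrite !mxE.
rewrite (kernel_iter_rowsub cK) //.
have := kernel_iter_rowsub (dsum_compatible_tr cK) l P^T oW oiW.
rewrite trmxK => /(congr1 trmx); rewrite trmxK.
have -> : (rowsub (tidx l) P^T)^T = colsub (tidx l) P.
  by apply/matrixP => i j; rewrite !mxE.
by move=> ->; apply/matrixP => i j; rewrite !mxE.
Qed.

End DirectSums.

(** * Positive operator matrices and operator norms *)

Section OperatorMatrices.
Context {R : realType}.

Definition linear_mx {X Y : hilbertType R} p q (T : 'M[X -> Y]_(p, q)) : Prop :=
  forall i j, linear (T i j).

Section Linear.
Context {X Y : hilbertType R} {p q : nat} (T : 'M[X -> Y]_(p, q)).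
Hypothesis linT : linear_mx T.

Lemma linear_mxD i j x y : T i j (x + y) = T i j x + T i j y.
Proof. by rewrite -[x]scale1r linT !scale1r. Qed.

Lemma linear_mx0 i j : T i j 0 = 0.
Proof. by apply: (addIr (T i j 0)); rewrite -linear_mxD !add0r. Qed.

Lemma linear_mxZ i j c x : T i j (c *: x) = c *: T i j x.
Proof. by rewrite -[c *: x]addr0 linT linear_mx0 addr0. Qed.

Lemma mx_appD x y : mx_app T (x + y) = mx_app T x + mx_app T y.
Proof.
apply/matrixP => i j; rewrite !mxE -big_split; apply: eq_bigr => k _.
by rewrite mxE linear_mxD.
Qed.

Lemma mx_appZ c x : mx_app T (scale_col c x) = scale_col c (mx_app T x).
Proof.
apply/matrixP => i j; rewrite !mxE scaler_sumr; apply: eq_bigr => k _.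
by rewrite mxE linear_mxZ.
Qed.

Lemma mx_app0 : mx_app T 0 = 0.
Proof. by apply: (addIr (mx_app T 0)); rewrite -mx_appD !add0r. Qed.

End Linear.

Lemma mx_act_block {V X : Type} {Y : zmodType} (act : V -> X -> Y) p p' q q'
    (T11 : 'M[V]_(p, q)) (T12 : 'M[V]_(p, q')) T21 (T22 : 'M[V]_(p', q')) x y :
  mx_act act (block_mx T11 T12 T21 T22) (col_mx x y) =
  col_mx (mx_act act T11 x + mx_act act T12 y) (mx_act act T21 x + mx_act act T22 y).
Proof.
apply/matrixP => i j; rewrite ord1 mxE.
case: (split_ordP i) => k ->; rewrite big_split_ord /= ?col_mxEu ?col_mxEd !mxE;
  congr (_ + _); apply: eq_bigr => l _;
  by rewrite ?block_mxEul ?block_mxEur ?block_mxEdl ?block_mxEdr ?col_mxEu ?col_mxEd.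
Qed.

Lemma mx_app_block {X Y : hilbertType R} p p' q q'
    (T11 : 'M[X -> Y]_(p, q)) (T12 : 'M[X -> Y]_(p, q')) T21 (T22 : 'M[X -> Y]_(p', q')) x y :
  mx_app (block_mx T11 T12 T21 T22) (col_mx x y) =
  col_mx (mx_app T11 x + mx_app T12 y) (mx_app T21 x + mx_app T22 y).
Proof. exact: mx_act_block. Qed.

Lemma cdot_col_mx {Y : hilbertType R} p q (a c : 'cV[Y]_p) (b d : 'cV[Y]_q) :
  cdot (col_mx a b) (col_mx c d) = cdot a c + cdot b d.
Proof.
rewrite /cdot big_split_ord /=; congr (_ + _); apply: eq_bigr => i _.
  by rewrite !col_mxEu.
by rewrite !col_mxEd.
Qed.

Lemma csq_col_mx {Y : hilbertType R} p q (a : 'cV[Y]_p) (b : 'cV[Y]_q) :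
  csq (col_mx a b) = csq a + csq b.
Proof. by rewrite -!cdotxx cdot_col_mx. Qed.

Section ColDot.
Context {Y : hilbertType R} {n : nat}.
Implicit Types x y z : 'cV[Y]_n.

Lemma col_dotDl x y z : col_dot (x + y) z = col_dot x z + col_dot y z.
Proof. by rewrite -big_split; apply: eq_bigr => i _; rewrite mxE linearDl. Qed.

Lemma col_dotDr x y z : col_dot z (x + y) = col_dot z x + col_dot z y.
Proof. by rewrite -big_split; apply: eq_bigr => i _; rewrite mxE linearDr. Qed.

Lemma col_dotZl c x y : col_dot (scale_col c x) y = c * col_dot x y.
Proof. by rewrite mulr_sumr; apply: eq_bigr => i _; rewrite mxE linearZl_LR. Qed.

Lemma col_dotZr c x y : col_dot y (scale_col c x) = Num.conj c * col_dot y x.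
Proof. by rewrite mulr_sumr; apply: eq_bigr => i _; rewrite mxE linearZr_LR. Qed.

End ColDot.

Section Positive.
Context {Y : hilbertType R} {n : nat} (T : 'M[Y -> Y]_n).
Hypotheses (linT : linear_mx T) (posT : pos_op T).

Lemma pos_op_cdot y : 0 <= cdot (mx_app T y) y.
Proof. by rewrite cdotE; have := posT y; rewrite lecE => /andP[]. Qed.

(* A complex sesquilinear form that is real on the diagonal is hermitian. *)
Lemma pos_op_sym x y : cdot (mx_app T y) x = cdot (mx_app T x) y.
Proof.
have im0 z : complex.Im (col_dot (mx_app T z) z) = 0.
  by have := posT z; rewrite lecE => /andP[/eqP].
have im2 u v : complex.Im (col_dot (mx_app T u) v + col_dot (mx_app T v) u) = 0.
  have := im0 (u + v); rewrite mx_appD // col_dotDl !col_dotDr !raddfD /=.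
  by rewrite !im0 addr0 add0r.
have ci : Num.conj ('i%C : R[i]) = - 'i%C by apply/eqP; rewrite eq_complex /= oppr0 !eqxx.
(* Replacing [y] by its multiple by i turns the vanishing imaginary part into the equality of the
   two real parts. *)
have := im2 (scale_col 'i%C y) x; rewrite mx_appZ // col_dotZl col_dotZr ci.
rewrite mulNr -mulrBr !cdotE.
case: (col_dot (mx_app T y) x) (col_dot (mx_app T x) y) => a b [c d] /=.
by rewrite mul0r mul1r add0r => /subr0_eq.
Qed.

Lemma pos_op_schwarz x y :
  cdot (mx_app T y) x ^+ 2 <= cdot (mx_app T x) x * cdot (mx_app T y) y.
Proof.
apply: discriminant_le0 (pos_op_cdot y) _ => t.
have := pos_op_cdot (x + scale_col t%:C y); rewrite mx_appD // mx_appZ //.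
rewrite cdotDl !cdotDr !cdotZl !cdotZr (pos_op_sym y x).
by rewrite -/(cdot _ _); set a := cdot _ _; set b := cdot _ _; set c := cdot _ _; lra.
Qed.

(** The quadratic form of a positive operator controls its norm: the Schwarz inequality at [y] and z
    = T y gives |z|^4 <= M |z|^2 M |y|^2. *)
Lemma pos_op_bound M y : 0 <= M ->
  (forall z, cdot (mx_app T z) z <= M * csq z) ->
  csq (mx_app T y) <= M ^+ 2 * csq y.
Proof.
move=> M0 TM; set z := mx_app T y.
have [u0|u0] := leP (csq z) 0.
  by apply: le_trans u0 _; rewrite mulr_ge0 ?sqr_ge0 ?csq_ge0.
have := pos_op_schwarz z y; rewrite -/z cdotxx.
have ab : cdot (mx_app T z) z * cdot z y <= (M * csq z) * (M * csq y).
  by apply: ler_pM; rewrite ?pos_op_cdot ?TM // ?(pos_op_cdot y) ?(TM y).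
move=> /le_trans/(_ ab); rewrite expr2 -mulrA mulrCA ler_pM2l //.
by rewrite mulrA -expr2.
Qed.

End Positive.

Lemma bounded_op_linear {X Y : hilbertType R} (f : X -> Y) : bounded_op f -> linear f.
Proof. by case. Qed.

Lemma bounded_op_rnorm {X Y : hilbertType R} (f : X -> Y) : bounded_op f ->
  exists2 M : R, 0 <= M & forall x, rnorm (f x) <= M * rnorm x.
Proof.
case=> _ [M fM]; exists `|complex.Re M| => // x.
have := fM x; rewrite !normE lecE => /andP[_] /=; case: M {fM} => a b /=.
rewrite mulr0 subr0 => /le_trans; apply.
by rewrite ler_wpM2r ?rnorm_ge0 ?ler_norm.
Qed.

End OperatorMatrices.

(** * Operator norms: from suprema in the extended reals to real inequalities *)

Section OpNorm.
Context {R : realType}.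

Lemma opnorm_le {U V : Type} (nU : U -> R) (nV : V -> R) (T : U -> V) (M : R) :
  (forall u, nU u <= 1 -> nV (T u) <= M) ->
  (opnorm (fun u => (nU u)%:E) (fun v => (nV v)%:E) T <= M%:E)%E.
Proof.
by move=> TM; apply: ub_ereal_sup => _ [u /= u1 <-]; rewrite lee_fin TM // -lee_fin.
Qed.

Lemma opnorm_ge {U V : Type} (nU : U -> \bar R) (nV : V -> \bar R) (T : U -> V) u :
  (nU u <= 1%:E)%E -> (nV (T u) <= opnorm nU nV T)%E.
Proof. by move=> u1; apply: ereal_sup_ubound; exists u. Qed.

Lemma opnorm_bound {U V : Type} (nU : U -> R) (nV : V -> R) (T : U -> V)
    (scale : R -> U -> U) (M : R) :
  (forall u, 0 <= nU u) ->
  (forall t u, 0 <= t -> nU (scale t u) = t * nU u) ->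
  (forall t u, 0 <= t -> nV (T (scale t u)) = t * nV (T u)) ->
  (opnorm (fun u => (nU u)%:E) (fun v => (nV v)%:E) T <= M%:E)%E ->
  forall u, nV (T u) <= M * nU u.
Proof.
move=> nU0 sU sV TM u.
have TM1 v : nU v <= 1 -> nV (T v) <= M.
  by move=> v1; rewrite -lee_fin; apply: le_trans TM; apply: opnorm_ge; rewrite lee_fin.
have := nU0 u; rewrite le_eqVlt => /predU1P[u0|u0]; last first.
  have i0 : 0 <= (nU u)^-1 by rewrite invr_ge0 ltW.
  have := TM1 (scale (nU u)^-1 u); rewrite sU // sV // mulVf ?gt_eqF // => /(_ (lexx _)).
  by rewrite mulrC ler_pdivrMr.
rewrite -u0 mulr0 leNgt; apply/negP => Tu.
(* When [nU u] is 0, every multiple of [u] lies in the unit ball, and this factor would push the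
   value to |M| + 1. *)
have t0 : 0 <= (`|M| + 1) / nV (T u) by rewrite divr_ge0 ?ltW // addr_ge0.
have := TM1 (scale ((`|M| + 1) / nV (T u)) u).
rewrite sU // sV // -u0 mulr0 => /(_ ler01).
rewrite divfK ?gt_eqF // => h.
by have := ler_norm M; lra.
Qed.

Lemma col_norm_le1 {H : hilbertType R} n (x : 'cV[H]_n) :
  (col_norm (@rnorm R H) x <= 1) = (csq x <= 1).
Proof. by rewrite -(@expr_le1 _ 2) ?col_norm_ge0 // col_norm_sq. Qed.

Lemma col_norm_le {H : hilbertType R} n (x : 'cV[H]_n) M : 0 <= M ->
  (col_norm (@rnorm R H) x <= M) = (csq x <= M ^+ 2).
Proof.
by move=> M0; rewrite -(@ler_pXn2r _ 2) ?nnegrE ?col_norm_ge0 // col_norm_sq.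
Qed.

Lemma col_normZ {H : hilbertType R} n (x : 'cV[H]_n) t : 0 <= t ->
  col_norm (@rnorm R H) (scale_col t%:C x) = t * col_norm (@rnorm R H) x.
Proof.
move=> t0; apply/eqP; rewrite -(@eqrXn2 _ 2) ?mulr_ge0 ?col_norm_ge0 //.
by rewrite exprMn !col_norm_sq csqZ rnormC.
Qed.

Section Matrix.
Context {X Y : hilbertType R} {p q : nat} (T : 'M[X -> Y]_(p, q)).
Hypothesis bT : forall i j, bounded_op (T i j).

Let linT : linear_mx T. Proof. by move=> i j; apply: bounded_op_linear. Qed.

Lemma op_norm_le M : 0 <= M ->
  (forall x, csq (mx_app T x) <= M ^+ 2 * csq x) -> (op_norm T <= M%:E)%E.
Proof.
move=> M0 TM; apply: opnorm_le => x /=; rewrite col_norm_le1 => x1.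
rewrite col_norm_le //; apply: le_trans (TM x) _.
by rewrite ler_piMr ?sqr_ge0.
Qed.

Lemma op_norm_bound M x : 0 <= M -> (op_norm T <= M%:E)%E ->
  csq (mx_app T x) <= M ^+ 2 * csq x.
Proof.
move=> M0 TM.
have := opnorm_bound (scale := fun t => scale_col t%:C) (@col_norm_ge0 _ _ _)
  (fun t u t0 => col_normZ u t0) _ TM x.
rewrite /= -[csq (_ x)]col_norm_sq -[csq x]col_norm_sq -exprMn.
rewrite ler_pXn2r ?nnegrE ?mulr_ge0 ?col_norm_ge0 //; apply.
by move=> t u t0; rewrite -/(mx_app T _) mx_appZ // col_normZ.
Qed.

Lemma op_norm_ge0 : (0%:E <= op_norm T)%E.
Proof.
apply: (@le_trans _ _ (col_norm (@rnorm R Y) (mx_app T 0))%:E).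
  by rewrite lee_fin col_norm_ge0.
have := opnorm_ge (nU := fun x : 'cV[X]_q => (col_norm (@rnorm R X) x)%:E)
  (fun y => (col_norm (@rnorm R Y) y)%:E) (mx_app T) (u := 0).
by apply; rewrite lee_fin col_norm_le1 csq0.
Qed.

(** Bounds for the entries combine to a crude finite bound. The exact norm can then be named as a
    real number and used in real arithmetic. *)
Lemma op_norm_fin : exists2 a, 0 <= a & op_norm T = a%:E.
Proof.
have /choice [M TM] : forall ij : 'I_p * 'I_q, exists M : R,
    0 <= M /\ forall x, rnorm (T ij.1 ij.2 x) <= M * rnorm x.
  by move=> [i j]; have [M M0 hM] := bounded_op_rnorm (bT i j); exists M.
have le_fin : (op_norm T <= (Num.sqrt (\sum_i (\sum_j M (i, j)) ^+ 2))%:E)%E.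
  apply: opnorm_le => x /=; rewrite col_norm_le1 => x1.
  apply: ler_wsqrtr; apply: ler_sum => i _.
  rewrite ler_pXn2r ?nnegrE ?rnorm_ge0 ?sumr_ge0 //; last first.
    by move=> j _; case: (TM (i, j)).
  rewrite mxE; apply: (@le_trans _ _ (\sum_j rnorm (T i j (x j 0)))).
    apply: (big_ind2 (fun a t => rnorm a <= t)) => //; first by rewrite rnorm0.
    by move=> a s b t ha hb; apply: le_trans (ler_rnormD _ _) (lerD ha hb).
  apply: ler_sum => j _; have [M0 hM] := TM (i, j); apply: le_trans (hM _) _.
  rewrite ler_piMr // -(@expr_le1 _ 2) ?rnorm_ge0 //.
  exact: le_trans (csq_entry x j) x1.
have := op_norm_ge0; move: le_fin; case: (op_norm T) => [a||] //= _.
by rewrite lee_fin; exists a.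
Qed.

End Matrix.
End OpNorm.

(** * Complete boundedness of the kernel *)

Section Flattening.
Context {R : realType}.

Lemma sum_tidx (V : nmodType) r m (F : 'I_(r * m) -> V) :
  \sum_t F t = \sum_k \sum_i F (tidx k i).
Proof.
rewrite pair_big /= (reindex (fun ki : 'I_r * 'I_m => mxtens_index ki)) /=.
  by apply: eq_bigr => -[k i] _.
by exists (@mxtens_unindex _ _) => t _; rewrite ?mxtens_indexK ?mxtens_unindexK.
Qed.

Definition flat {T : Type} r m (F : 'I_r -> 'cV[T]_m) : 'cV[T]_(r * m) :=
  \col_t F (mxtens_unindex t).1 (mxtens_unindex t).2 0.

Lemma rowsub_flat {T : Type} r m (F : 'I_r -> 'cV[T]_m) k :
  rowsub (tidx k) (flat F) = F k.
Proof. by apply/matrixP => i j; rewrite !mxE mxtens_indexK ord1. Qed.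

Definition flat_mx {T : Type} r s n m (F : 'I_r -> 'I_s -> 'M[T]_(n, m)) :
    'M[T]_(r * n, s * m) :=
  \matrix_(t, u) F (mxtens_unindex t).1 (mxtens_unindex u).1
                   (mxtens_unindex t).2 (mxtens_unindex u).2.

Lemma mxsub_flat {T : Type} r s n m (F : 'I_r -> 'I_s -> 'M[T]_(n, m)) k l :
  mxsub (tidx k) (tidx l) (flat_mx F) = F k l.
Proof. by apply/matrixP => i j; rewrite !mxE !mxtens_indexK. Qed.

Lemma cdot_flat {H : hilbertType R} r m (x y : 'cV[H]_(r * m)) :
  cdot x y = \sum_k cdot (rowsub (tidx k) x) (rowsub (tidx k) y).
Proof.
rewrite /cdot sum_tidx; apply: eq_bigr => k _; apply: eq_bigr => i _.
by rewrite !mxE.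
Qed.

Lemma csq_flat {H : hilbertType R} r m (x : 'cV[H]_(r * m)) :
  csq x = \sum_k csq (rowsub (tidx k) x).
Proof. by rewrite -cdotxx cdot_flat; apply: eq_bigr => k _; rewrite cdotxx. Qed.

Lemma mx_act_flat {V X : Type} {Y : zmodType} (act : V -> X -> Y) r s n m
    (T : 'M[V]_(r * n, s * m)) (x : 'cV[X]_(s * m)) k :
  rowsub (tidx k) (mx_act act T x) =
  \sum_l mx_act act (mxsub (tidx k) (tidx l) T) (rowsub (tidx l) x).
Proof.
apply/matrixP => i j; rewrite !mxE summxE sum_tidx; apply: eq_bigr => l _.
by rewrite mxE; apply: eq_bigr => i' _; rewrite !mxE.
Qed.

Lemma cdot_suml {H : hilbertType R} {n} I (r : seq I) (P : pred I) (F : I -> 'cV[H]_n) y :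
  cdot (\sum_(i <- r | P i) F i) y = \sum_(i <- r | P i) cdot (F i) y.
Proof.
apply: (big_morph (fun x => cdot x y)) => [a b|]; first exact: cdotDl.
exact: cdot0l.
Qed.

(** Amplifying a space of matrices produces columns of columns. Their squared norm agrees with that
    of the flattened column, where direct sums of points live. *)
Definition nested_sq {H : hilbertType R} r m (x : 'cV['cV[H]_m]_r) : R :=
  \sum_k csq (x k 0).

Lemma nested_norm_sq {H : hilbertType R} r m (x : 'cV['cV[H]_m]_r) :
  col_norm (fun y => col_norm (@rnorm R H) y) x ^+ 2 = nested_sq x.
Proof.
rewrite sqr_sqrtr; first by apply: eq_bigr => k _; rewrite col_norm_sq.
by apply: sumr_ge0 => k _; apply: sqr_ge0.
Qed.

Lemma nested_norm_ge0 {H : hilbertType R} r m (x : 'cV['cV[H]_m]_r) :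
  0 <= col_norm (fun y => col_norm (@rnorm R H) y) x.
Proof. exact: sqrtr_ge0. Qed.

Lemma nested_sq_ge0 {H : hilbertType R} r m (x : 'cV['cV[H]_m]_r) : 0 <= nested_sq x.
Proof. by apply: sumr_ge0 => k _; apply: csq_ge0. Qed.

Lemma nested_norm_le {H : hilbertType R} r m (x : 'cV['cV[H]_m]_r) M : 0 <= M ->
  (col_norm (fun y => col_norm (@rnorm R H) y) x <= M) = (nested_sq x <= M ^+ 2).
Proof.
by move=> M0; rewrite -(@ler_pXn2r _ 2) ?nnegrE ?nested_norm_ge0 // nested_norm_sq.
Qed.

Definition nested_scale {H : hilbertType R} r m (t : R) (x : 'cV['cV[H]_m]_r) :
  'cV['cV[H]_m]_r := map_mx (scale_col t%:C) x.

Lemma nested_normZ {H : hilbertType R} r m t (x : 'cV['cV[H]_m]_r) : 0 <= t ->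
  col_norm (fun y => col_norm (@rnorm R H) y) (nested_scale t x) =
  t * col_norm (fun y => col_norm (@rnorm R H) y) x.
Proof.
move=> t0; apply/eqP; rewrite -(@eqrXn2 _ 2) ?mulr_ge0 ?nested_norm_ge0 //.
rewrite exprMn !nested_norm_sq mulr_sumr; apply/eqP/eq_bigr => k _.
by rewrite mxE csqZ rnormC.
Qed.

Lemma scale_col_sum {H : hilbertType R} {n} I (r : seq I) (P : pred I) (F : I -> 'cV[H]_n) c :
  scale_col c (\sum_(i <- r | P i) F i) = \sum_(i <- r | P i) scale_col c (F i).
Proof.
apply/matrixP => i j; rewrite mxE !summxE scaler_sumr.
by apply: eq_bigr => k _; rewrite mxE.
Qed.

Lemma eq_lee (x y : \bar R) : x = y -> (x <= y)%E.
Proof. by move=> ->. Qed.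

Lemma opnorm_lee {U V : Type} (nU : U -> \bar R) (nV : V -> \bar R) (T : U -> V) M :
  (forall u, (nU u <= 1%:E)%E -> (nV (T u) <= M)%E) -> (opnorm nU nV T <= M)%E.
Proof. by move=> TM; apply: ub_ereal_sup => _ [u /= u1 <-]; apply: TM. Qed.

Lemma sqr_cancel (M s t : R) : 0 <= s -> 0 <= t ->
  s ^+ 2 <= (M * s) * (M * t) -> s <= M ^+ 2 * t.
Proof.
rewrite le_eqVlt => /predU1P[<-|s0] t0; first by rewrite mulr_ge0 ?sqr_ge0.
by rewrite expr2 -mulrA mulrCA ler_pM2l // mulrA -expr2.
Qed.

Section Alg.
Context {A : cstarType R} {E : hilbertType R} (rho : A -> E -> E).
Hypothesis rep : star_rep rho.

Lemma rep_mxZ p q (V : 'M[A]_(p, q)) c x :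
  mx_act rho V (scale_col c x) = scale_col c (mx_act rho V x).
Proof.
apply/matrixP => i j; rewrite !mxE scaler_sumr; apply: eq_bigr => k _.
by rewrite mxE (repvZ rep).
Qed.

Lemma rep_mx_zero p q (x : 'cV[E]_q) : mx_act rho (0 : 'M[A]_(p, q)) x = 0.
Proof.
by apply/matrixP => i j; rewrite !mxE big1 // => k _; rewrite mxE (rep0 rep).
Qed.

Lemma os_alg_contractive p q (V : 'M[A]_(p, q)) :
  (os_norm (os_mx p q (os_alg rho)) V <= 1)%E -> contractive rho V.
Proof.
move=> V1 x.
have := opnorm_bound (scale := fun t => scale_col t%:C) (@col_norm_ge0 _ _ _)
  (fun t u t0 => col_normZ u t0) _ V1 x.
rewrite /= mul1r -[csq (mx_act _ _ _)]col_norm_sq -[csq x]col_norm_sq.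
rewrite ler_pXn2r ?nnegrE ?col_norm_ge0 //; apply.
by move=> t u t0; rewrite rep_mxZ col_normZ.
Qed.

Lemma contractive_os_alg p q (V : 'M[A]_(p, q)) :
  contractive rho V -> (os_norm (os_mx p q (os_alg rho)) V <= 1)%E.
Proof.
move=> V1; apply: opnorm_le => x /=; rewrite !col_norm_le1.
exact: le_trans (V1 x).
Qed.

Lemma os_alg_nested r s n m (P : 'M['M[A]_(n, m)]_(r, s)) :
  (os_norm (os_mx r s (os_mx n m (os_alg rho))) P <= 1)%E ->
  forall x, nested_sq (mx_act (fun T y => mx_act rho T y) P x) <= nested_sq x.
Proof.
move=> P1 x.
have := opnorm_bound (scale := @nested_scale E s m) (@nested_norm_ge0 _ _ _)
  (fun t u t0 => nested_normZ u t0) _ P1 x.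
rewrite /= mul1r -[nested_sq (mx_act _ _ _)]nested_norm_sq -[nested_sq x]nested_norm_sq.
rewrite ler_pXn2r ?nnegrE ?nested_norm_ge0 //; apply.
move=> t u t0; rewrite -nested_normZ //; congr (col_norm _ _).
apply/matrixP => i j; rewrite !mxE scale_col_sum; apply: eq_bigr => k _.
by rewrite mxE rep_mxZ.
Qed.

Lemma nested_os_alg r s n m (P : 'M['M[A]_(n, m)]_(r, s)) :
  (forall x, nested_sq (mx_act (fun T y => mx_act rho T y) P x) <= nested_sq x) ->
  (os_norm (os_mx r s (os_mx n m (os_alg rho))) P <= 1)%E.
Proof.
move=> P1; apply: opnorm_le => x /=; rewrite !nested_norm_le // expr1n.
exact: le_trans (P1 x).
Qed.

End Alg.
End Flattening.

(** * Schwarz inequality and cb bounds for a cp kernel *)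

Section KernelBounds.
Context {R : realType} {S : Type} (s0 : S).
Context (Omega : forall n, set 'M[S]_n).
Context {A : cstarType R} {E Y : hilbertType R} (rho : A -> E -> E).
Variable K : forall n m, 'M[S]_n -> 'M[S]_m -> 'M[A]_(n, m) -> 'M[Y -> Y]_(n, m).
Hypotheses (rho_faithful : faithful_rep rho) (Omega_nc : nc_set s0 Omega).
Hypotheses (K_global : global_kernel s0 Omega K) (K_cp : cp_kernel Omega K).

Let rep : star_rep rho := proj1 rho_faithful.
Let inj : injective rho := proj2 rho_faithful.

Lemma Omega_dsum n m Z W : Omega Z -> Omega W -> Omega (dsum s0 (Z : 'M[S]_n) (W : 'M[S]_m)).
Proof. exact: (proj2 Omega_nc). Qed.

Lemma kernel_linear n m Z W P : Omega Z -> Omega W -> linear_mx (@K n m Z W P).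
Proof. by move=> oZ oW i j; case: (gk_bounded K_global oZ oW P i j). Qed.

Lemma kernelD n m Z W P Q y : Omega Z -> Omega W ->
  mx_app (@K n m Z W (P + Q)) y = mx_app (K Z W P) y + mx_app (K Z W Q) y.
Proof.
move=> oZ oW; apply/matrixP => i j; rewrite !mxE -big_split; apply: eq_bigr => k _ /=.
have := gk_linear K_global oZ oW 1 P Q i k (y k 0); rewrite scale1r => <-.
by congr (K Z W (_ + _) i k _); apply/matrixP => a b; rewrite mxE scale1r.
Qed.

Lemma kernel0 n m Z W y : Omega Z -> Omega W -> mx_app (@K n m Z W 0) y = 0.
Proof.
move=> oZ oW; apply: (addIr (mx_app (K Z W 0) y)).
by rewrite -kernelD // !add0r.
Qed.

Lemma kernel_dsum : dsum_compatible s0 Omega K.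
Proof. by move=> *; apply: (gk_dsum K_global). Qed.

Lemma pos_mx1 n : pos_mx (1%:M : 'M[A]_n).
Proof. by exists 1%:M; rewrite mulmx1 star_mx1. Qed.

Lemma kernel_cdot1_ge0 n (Z : 'M[S]_n) y : Omega Z -> 0 <= cdot (mx_app (K Z Z 1%:M) y) y.
Proof. by move=> oZ; apply/pos_op_cdot/K_cp => //; apply: pos_mx1. Qed.

(* [[1, P], [P^*, 1]] = C^* C for [C = [[P^*, 1], [Q, 0]]] with
   [1 - P P^* = Q^* Q]. *)
Lemma kernel_schwarz n (Z : 'M[S]_n) (P : 'M[A]_n) x y : Omega Z -> contractive rho P ->
  cdot (mx_app (K Z Z P) y) x ^+ 2 <=
  cdot (mx_app (K Z Z 1%:M) x) x * cdot (mx_app (K Z Z 1%:M) y) y.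
Proof.
move=> oZ cP.
have [Q eqQ] := pos_one_minus rep inj (contractive_star rep cP).
rewrite star_mxK in eqQ.
pose B := block_mx 1%:M P (star_mx P) 1%:M.
have posB : pos_mx B.
  exists (block_mx (star_mx P) 1%:M Q 0).
  have -> : star_mx (block_mx (star_mx P) 1%:M Q 0) = block_mx P (star_mx Q) 1%:M 0.
    apply/matrixP => i j; rewrite mxE.
    case: (split_ordP i) => i' ->; case: (split_ordP j) => j' ->;
    rewrite ?block_mxEul ?block_mxEur ?block_mxEdl ?block_mxEdr ?mxE ?starK ?star0A //.
    by rewrite eq_sym; case: eqP => _; rewrite ?star1 ?star0A.
  rewrite mulmx_block !mulmx1 !mul1mx !mulmx0 !mul0mx !addr0 -eqQ.
  by rewrite addrC subrK.
have oZZ := Omega_dsum oZ oZ.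
(* Vectors supported in different halves isolate the corner [P] in the cross term and the two unit
   corners in the diagonal terms. *)
have := pos_op_schwarz (kernel_linear B oZZ oZZ) (K_cp oZZ posB) (col_mx x 0) (col_mx 0 y).
rewrite (gk_dsum K_global) // !mx_app_block !cdot_col_mx.
by rewrite !mx_app0 ?add0r ?addr0; try exact: kernel_linear; rewrite !cdot0r ?addr0 ?add0r.
Qed.

Section Iterated.
Variables (m : nat) (W : 'M[S]_m) (r : nat).
Hypotheses (oW : Omega W) (r0 : (0 < r)%N).
Let rW := dsum_iter s0 r W.

Lemma kernel_iter_app P y k :
  rowsub (tidx k) (mx_app (K rW rW P) y) =
  \sum_l mx_app (K W W (mxsub (tidx k) (tidx l) P)) (rowsub (tidx l) y).
Proof.
rewrite /mx_app mx_act_flat; apply: eq_bigr => l _.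
by rewrite -(kernel_iter_mxsub Omega_nc _ _ _ kernel_dsum).
Qed.

Lemma kernel_iter_cdot P y x :
  cdot (mx_app (K rW rW P) y) x =
  \sum_k \sum_l cdot (mx_app (K W W (mxsub (tidx k) (tidx l) P)) (rowsub (tidx l) y))
                     (rowsub (tidx k) x).
Proof. by rewrite cdot_flat; apply: eq_bigr => k _; rewrite kernel_iter_app cdot_suml. Qed.

Lemma mxsub_scalar1 k l :
  mxsub (tidx k) (tidx l) (1%:M : 'M[A]_(r * m)) = if k == l then 1%:M else 0.
Proof.
have [<-|kl] := eqVneq k l; apply/matrixP => i j; rewrite !mxE.
  by rewrite (can_eq (@mxtens_indexK _ _)) xpair_eqE eqxx.
by rewrite (can_eq (@mxtens_indexK _ _)) xpair_eqE (negPf kl).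
Qed.

(** At the unit the kernel of the iterated sum is block diagonal with equal blocks, so the bound
    does not grow with [r]. *)
Lemma kernel_iter1_le M y : (forall z, cdot (mx_app (K W W 1%:M) z) z <= M * csq z) ->
  cdot (mx_app (K rW rW 1%:M) y) y <= M * csq y.
Proof.
move=> WM; rewrite kernel_iter_cdot csq_flat mulr_sumr; apply: ler_sum => k _.
rewrite (bigD1 k) //= mxsub_scalar1 eqxx big1 ?addr0 // => l lk.
rewrite mxsub_scalar1 eq_sym (negPf lk) kernel0 //.
exact: cdot0l.
Qed.

End Iterated.

Lemma op_norm_cdot_le n (Z : 'M[S]_n) a : Omega Z -> 0 <= a ->
  (op_norm (K Z Z 1%:M) <= a%:E)%E -> forall y, cdot (mx_app (K Z Z 1%:M) y) y <= a * csq y.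
Proof.
move=> oZ a0 Ka y.
rewrite -(@ler_pXn2r _ 2) ?nnegrE ?kernel_cdot1_ge0 ?mulr_ge0 ?csq_ge0 //.
apply: le_trans (cdot_sqr_le _ _) _; rewrite exprMn expr2 [csq y ^+ 2]expr2 mulrA.
rewrite ler_wpM2r ?csq_ge0 // -expr2; apply: op_norm_bound => //.
by move=> i j; apply: (gk_bounded K_global).
Qed.

Lemma op_norm_dsum n m Z W : Omega Z -> Omega W ->
  let U := dsum s0 (Z : 'M[S]_n) (W : 'M[S]_m) in
  op_norm (K U U 1%:M) = maxe (op_norm (K Z Z 1%:M)) (op_norm (K W W 1%:M)).
Proof.
move=> oZ oW U; have oU : Omega U by apply: Omega_dsum.
have bK p (V : 'M[S]_p) P i j : Omega V -> bounded_op (K V V P i j).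
  by move=> oV; apply: (gk_bounded K_global).
have [a a0 Ka] := op_norm_fin (fun i j => bK n Z 1%:M i j oZ).
have [b b0 Kb] := op_norm_fin (fun i j => bK m W 1%:M i j oW).
have [c c0 Kc] := op_norm_fin (fun i j => bK _ U 1%:M i j oU).
have KU x y : csq (mx_app (K U U 1%:M) (col_mx x y)) =
    csq (mx_app (K Z Z 1%:M) x) + csq (mx_app (K W W 1%:M) y).
  rewrite scalar_mx_block (gk_dsum K_global) // mx_app_block !kernel0 //.
  by rewrite add0r addr0 csq_col_mx.
have Za x := op_norm_bound (fun i j => bK n Z 1%:M i j oZ) x a0 (eq_lee Ka).
have Wb x := op_norm_bound (fun i j => bK m W 1%:M i j oW) x b0 (eq_lee Kb).
have Uc x := op_norm_bound (fun i j => bK _ U 1%:M i j oU) x c0 (eq_lee Kc).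
apply/eqP; rewrite eq_le; apply/andP; split.
  rewrite Ka Kb -EFin_max; apply: op_norm_le => [|z]; first by rewrite le_max a0.
  rewrite -[z]vsubmxK KU csq_col_mx mulrDr; apply: lerD.
    apply: le_trans (Za _) _; rewrite ler_wpM2r ?csq_ge0 //.
    by rewrite ler_pXn2r ?nnegrE ?le_max ?a0 ?lexx.
  apply: le_trans (Wb _) _; rewrite ler_wpM2r ?csq_ge0 //.
  by rewrite ler_pXn2r ?nnegrE ?le_max ?b0 ?lexx ?orbT.
rewrite ge_max Kc; apply/andP; split; apply: op_norm_le => // x.
  have := Uc (col_mx x 0); rewrite KU csq_col_mx csq0 addr0.
  by have := csq_ge0 (mx_app (K W W 1%:M) 0); lra.
have := Uc (col_mx 0 x); rewrite KU csq_col_mx csq0 add0r.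
by have := csq_ge0 (mx_app (K Z Z 1%:M) 0); lra.
Qed.

(** Each P_kl becomes the upper right corner of a square block of size n + m, so the amplified
    rectangular map is a corner of [K] at one point, the [N]-fold sum of [U], where [kernel_schwarz]
    applies. *)
Lemma cb_norm_kernel_le n m (Z : 'M[S]_n) (W : 'M[S]_m) : Omega Z -> Omega W ->
  (cb_norm (os_mx n m (os_alg rho)) (os_mx n m (os_op Y Y)) (K Z W)
    <= op_norm (K (dsum s0 Z W) (dsum s0 Z W) 1%:M))%E.
Proof.
move=> oZ oW; set U := dsum s0 Z W; have oU : Omega U by apply: Omega_dsum.
have [M M0 KM] := op_norm_fin (fun i j => gk_bounded K_global oU oU 1%:M i j).
have leM := op_norm_cdot_le oU M0 (eq_lee KM).
rewrite KM; apply: ub_ereal_sup => _ [N /= N0 <-].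
apply: opnorm_lee => P P1; apply: opnorm_le => y /=; rewrite !nested_norm_le // expr1n.
move=> y1; set x := mx_act _ _ y.
pose Pb := flat_mx (fun k l => block_mx 0 (P k l) 0 0 : 'M[A]_(n + m)).
(* Inputs sit in the [W] half and outputs in the [Z] half. The output vector is [x] itself, so the
   cross term of the Schwarz inequality is the squared norm to be bounded. *)
pose yb := flat (fun l => col_mx 0 (y l 0) : 'cV[Y]_(n + m)).
pose xb := flat (fun k => col_mx (x k 0) 0 : 'cV[Y]_(n + m)).
have cPb : contractive rho Pb.
  move=> z; pose z' : 'cV['cV[E]_m]_N := \col_l dsubmx (rowsub (tidx l) z).
  have le_z : nested_sq z' <= csq z.
    rewrite csq_flat; apply: ler_sum => l _; rewrite mxE.
    by rewrite -[X in _ <= csq X]vsubmxK csq_col_mx lerDr csq_ge0.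
  apply: le_trans le_z; apply: le_trans (os_alg_nested rep P1 z').
  rewrite csq_flat; apply: ler_sum => k _; rewrite mx_act_flat.
  have -> : \sum_l mx_act rho (mxsub (tidx k) (tidx l) Pb) (rowsub (tidx l) z) =
      col_mx (mx_act (fun T y => mx_act rho T y) P z' k 0) 0.
    transitivity (\sum_l col_mx (mx_act rho (P k l) (z' l 0)) (0 : 'cV[E]_m)).
      apply: eq_bigr => l _; rewrite mxsub_flat mxE -{1}[rowsub _ z]vsubmxK.
      by rewrite mx_act_block !rep_mx_zero // add0r addr0.
    apply/matrixP => i j; rewrite summxE.
    case: (split_ordP i) => i' ->; rewrite ?col_mxEu ?col_mxEd !mxE ?summxE.
      by apply: eq_bigr => l _; rewrite col_mxEu.
    by rewrite big1 // => l _; rewrite col_mxEd mxE.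
  by rewrite csq_col_mx csq0 addr0.
have key : nested_sq x = cdot (mx_app (K (dsum_iter s0 N U) (dsum_iter s0 N U) Pb) yb) xb.
  rewrite kernel_iter_cdot //; apply: eq_bigr => k _.
  rewrite -cdotxx [x in cdot x _]mxE cdot_suml; apply: eq_bigr => l _.
  rewrite mxsub_flat !rowsub_flat (gk_dsum K_global) // mx_app_block cdot_col_mx.
  rewrite kernel0 // add0r cdot0r addr0.
  by rewrite mxE.
have oNU : Omega (dsum_iter s0 N U) by apply: Omega_iter.
have xbE : csq xb = nested_sq x.
  by rewrite csq_flat; apply: eq_bigr => k _; rewrite rowsub_flat csq_col_mx csq0 addr0.
have ybE : csq yb = nested_sq y.
  by rewrite csq_flat; apply: eq_bigr => k _; rewrite rowsub_flat csq_col_mx csq0 add0r.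
have := kernel_schwarz xb yb oNU cPb; rewrite -key => sch.
apply: (@le_trans _ _ (M ^+ 2 * nested_sq y)); last by rewrite ler_piMr ?sqr_ge0.
apply: sqr_cancel; rewrite ?nested_sq_ge0 //; apply: le_trans sch _.
by apply: ler_pM; rewrite ?kernel_cdot1_ge0 // -?xbE -?ybE; apply: kernel_iter1_le.
Qed.

End KernelBounds.

(** * Riesz representation and adjoints *)

Section Riesz.
Context {R : realType} {X : hilbertType R}.

Lemma rdot_sqr_le (x y : X) : rdot x y ^+ 2 <= rnorm x ^+ 2 * rnorm y ^+ 2.
Proof.
apply: discriminant_le0 (sqr_ge0 _) _ => t.
have := sqr_ge0 (rnorm (x + t%:C *: y)).
rewrite -(rdotxx (x + _)) rdotDl !rdotDr !rdotZl !rdotZr !rdotxx (rdotC y x).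
by rewrite expr2; lra.
Qed.

Lemma rdot_le (x y : X) : rdot x y <= rnorm x * rnorm y.
Proof.
have [xy0|xy0] := leP (rdot x y) 0.
  by apply: le_trans xy0 _; rewrite mulr_ge0 ?rnorm_ge0.
by rewrite -(@ler_pXn2r _ 2) ?nnegrE ?mulr_ge0 ?rnorm_ge0 ?(ltW xy0) // exprMn rdot_sqr_le.
Qed.

Lemma hilbert_complete (u : nat -> X) :
  (forall e : R, 0 < e -> exists N, forall m n, (N <= m)%N -> (N <= n)%N ->
     rnorm (u m - u n) < e) ->
  exists l, forall e : R, 0 < e -> exists N, forall n, (N <= n)%N -> rnorm (u n - l) < e.
Proof.
move=> cu.
have posC (e : R[i]) : 0 < e -> e = (complex.Re e)%:C /\ 0 < complex.Re e.
  by move=> e0; rewrite RRe_real ?gtr0_real // -ltcR RRe_real ?gtr0_real.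
have /cauchy_cvg/cvg_ex [l ul] : cauchy (u @ \oo).
  apply/cauchy_exP => e /posC[eE e0]; have [N uN] := cu _ e0.
  exists (u N); exists N => // n /= Nn.
  by rewrite -ball_normE /= eE normE ltcR; apply: uN.
exists l => e e0.
have : 0 < e%:C :> R[i] by rewrite ltcR.
move: ul => /cvgrPdist_lt ul /ul [N _ uN]; exists N => n Nn.
by have := uN n Nn; rewrite /= normE ltcR -rnormN opprB.
Qed.

(* The representing vector minimizes [|x|^2 - 2 l(x)]; minimizing sequences
   are Cauchy by the parallelogram law. *)
Lemma riesz (l : X -> R) (M : R) :
  (forall x y, l (x + y) = l x + l y) -> (forall t x, l (t%:C *: x) = t * l x) ->
  (forall x, l x <= M * rnorm x) -> exists z, forall x, l x = rdot x z.
Proof.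
move=> lD lZ lM; have [J JE] : exists J : X -> R, forall x, J x = rnorm x ^+ 2 - 2 * l x by eexists.
have J_ge x : - M ^+ 2 <= J x.
  by have := lM x; have := sqr_ge0 (rnorm x - M); rewrite JE; nra.
have infJ : has_inf (range J).
  by split; [exists (J 0), 0|exists (- M ^+ 2) => _ [x _ <-]].
have [m m_le m_inf] : exists2 m, (forall x, m <= J x) &
    forall e : R, 0 < e -> exists x, J x < m + e.
  exists (inf (range J)) => [x|e e0]; first by apply: inf_lbound; [case: infJ|exists x].
  by have [_ [x _ <-] Jx] := inf_adherent e0 infJ; exists x.
have /choice [u um] : forall n, exists x, J x < m + n.+1%:R^-1.
  by move=> n; apply: m_inf; rewrite invr_gt0.
(* The linear part of [J] cancels. As [J] is at least [m] at the midpoint, near-minimizers are close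
   together: excesses below e^2/4 give a distance below [e]. *)
have par x y : rnorm (x - y) ^+ 2 = 2 * J x + 2 * J y - 4 * J ((2^-1)%:C *: (x + y)).
  rewrite !JE lZ lD -!rdotxx rdotDl !rdotDr !rdotNl !rdotNr rdotZl rdotZr.
  by rewrite rdotDl !rdotDr (rdotC y x); field.
have inv_small e : 0 < e -> exists N : nat, forall n, (N <= n)%N -> n.+1%:R^-1 < e :> R.
  move=> e0; have [N] := near_infty_natSinv_lt (PosNum e0).
  by move=> _ hN; exists N => n /hN.
have [z zu] : exists z, forall e : R, 0 < e -> exists N, forall n, (N <= n)%N ->
    rnorm (u n - z) < e.
  apply: hilbert_complete => e e0.
  have [N hN] := inv_small (e ^+ 2 / 4) (divr_gt0 (exprn_gt0 2 e0) (ltr0n _ 4)).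
  exists N => i j Ni Nj; rewrite -(@ltr_pXn2r _ 2) ?nnegrE ?rnorm_ge0 ?(ltW e0) //.
  rewrite par; have := m_le ((2^-1)%:C *: (u i + u j)).
  have := um i; have := um j; have := hN i Ni; have := hN j Nj.
  move: (i.+1%:R^-1) (j.+1%:R^-1) (J (u i)) (J (u j)) (J _) => a b c d f; lra.
(* This is J(z + w) >= J(z), derived from the minimizing sequence itself, without continuity of [J].
   If the value were -v < 0, then e = v / (2 (1 + |w|)) exceeds both the excess of J(u_n) and the
   distance from u_n to [z], and their total effect e + 2 e |w| stays below v. *)
have var w : 0 <= 2 * (rdot w z - l w) + rnorm w ^+ 2.
  rewrite leNgt; apply/negP => v0.
  pose e := - (2 * (rdot w z - l w) + rnorm w ^+ 2) / (2 * (1 + rnorm w)).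
  have w1 : 0 < 2 * (1 + rnorm w) by have := rnorm_ge0 w; lra.
  have e0 : 0 < e by rewrite divr_gt0 // oppr_gt0.
  have ve : - (2 * (rdot w z - l w) + rnorm w ^+ 2) = 2 * e * (1 + rnorm w).
    by rewrite /e; field; have := rnorm_ge0 w; lra.
  have [N1 h1] := zu e e0; have [N2 h2] := inv_small e e0.
  pose n := maxn N1 N2.
  have un1 := h1 n (leq_maxl _ _); have un2 := h2 n (leq_maxr _ _).
  have := m_le (u n + w); have := um n.
  rewrite !JE lD -!rdotxx rdotDl !rdotDr (rdotC w (u n)) !rdotxx.
  have := rdot_le (u n - z) w; rewrite rdotDl rdotNl (rdotC z w).
  have := rnorm_ge0 w; have := rnorm_ge0 (u n - z).
  move: (rnorm (u n - z)) un1 (rnorm w) (n.+1%:R^-1) un2 ve => a ae b d de ve a0 b0 h3 h4 h5.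
  have : a * b <= e * b by rewrite ler_wpM2r // ltW.
  clearbody e; lra.
exists z => x; apply/esym/subr0_eq/eqP; rewrite -sqrf_eq0 eq_le sqr_ge0 andbT.
(* A quadratic in t without constant term can only be nonnegative if its linear coefficient
   vanishes. *)
rewrite -(mul0r (rnorm x ^+ 2)); apply: discriminant_le0 (sqr_ge0 _) _ => t.
have := var (t%:C *: x); rewrite rdotZl lZ -rdotxx rdotZl rdotZr rdotxx.
by rewrite expr2; lra.
Qed.

End Riesz.

Lemma sqr_le_cancel (R : realType) (s c : R) : 0 <= s -> 0 <= c -> s ^+ 2 <= s * c -> s <= c.
Proof.
rewrite le_eqVlt => /predU1P[<-//|s0] _.
by rewrite expr2 ler_pM2l.
Qed.

Section Adjoint.
Context {R : realType} {X Y : hilbertType R}.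

(** The representing vector shows that the choice defining [adjoint] does not fall back on its
    default value 0. It matches real parts only; testing on the multiple of [x] by i gives the
    imaginary parts. *)
Lemma adjointP (T : X -> Y) x y : bounded_op T -> hdot (T x) y = hdot x (adjoint T y).
Proof.
move=> bT; have [linT _] := bT; have [M M0 TM] := bounded_op_rnorm bT.
have TD u v : T (u + v) = T u + T v by rewrite -[u]scale1r linT !scale1r.
have T0 : T 0 = 0 by apply: (addIr (T 0)); rewrite -TD !add0r.
have TZ c u : T (c *: u) = c *: T u by rewrite -[c *: u]addr0 linT T0 addr0.
have [z zP] : exists z, forall x, rdot (T x) y = rdot x z.
  apply: (@riesz _ _ _ (M * rnorm y)) => [u v|t u|u].
  - by rewrite TD rdotDl.
  - by rewrite TZ rdotZl.
  - apply: le_trans (rdot_le _ _) _; rewrite mulrAC ler_wpM2r ?rnorm_ge0 //.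
suff zT : forall x, hdot (T x) y = hdot x z.
  have := @xgetPex _ 0 [set z | forall x, hdot (T x) y = hdot x z]; apply.
  by exists z.
move=> {}x; have := zP x; have := zP ('i%C *: x).
rewrite /rdot TZ !linearZl_LR /=.
case: (hdot (T x) y) (hdot x z) => a b [c d] /=.
by rewrite !mul0r !mul1r !sub0r => /oppr_inj -> ->.
Qed.

Lemma adjoint_mx_cdot p q (T : 'M[X -> Y]_(p, q)) x y :
  (forall i j, bounded_op (T i j)) ->
  cdot (mx_app T x) y = cdot x (mx_app (adjoint_mx T) y).
Proof.
move=> bT; rewrite /cdot.
under eq_bigr => i _ do rewrite mxE rdot_suml.
rewrite exchange_big /=; apply: eq_bigr => j _; rewrite mxE rdot_sumr.
by apply: eq_bigr => i _; rewrite mxE /rdot adjointP.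
Qed.

(** This is |T|^2 = |T T^*|. Bounds on the adjoint are read off from |T^* y|^2 = <B y, y>, once
    through the norm of [B] and once through that of [T]. *)
Lemma op_norm_adjoint p q (T : 'M[X -> Y]_(p, q)) (B : 'M[Y -> Y]_p) :
  (forall i j, bounded_op (T i j)) -> (forall i j, bounded_op (B i j)) ->
  (forall y, mx_app B y = mx_app T (mx_app (adjoint_mx T) y)) ->
  op_norm T = sqrte (op_norm B).
Proof.
move=> bT bB BE.
have [a a0 Ba] := op_norm_fin bB; have [b b0 Tb] := op_norm_fin bT.
have Bb y := op_norm_bound bB y a0 (eq_lee Ba).
have Tbb x := op_norm_bound bT x b0 (eq_lee Tb).
have adj y : csq (mx_app (adjoint_mx T) y) = cdot (mx_app B y) y.
  by rewrite BE adjoint_mx_cdot // cdotxx.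
have adj_le y : csq (mx_app (adjoint_mx T) y) <= a * csq y.
  rewrite -(@ler_pXn2r _ 2) ?nnegrE ?mulr_ge0 ?csq_ge0 // adj.
  apply: le_trans (cdot_sqr_le _ _) _; rewrite exprMn expr2 [csq y ^+ 2]expr2 mulrA.
  by rewrite ler_wpM2r ?csq_ge0 // -expr2.
have le1 : (op_norm T <= (Num.sqrt a)%:E)%E.
  apply: op_norm_le => [|x]; first exact: sqrtr_ge0.
  rewrite sqr_sqrtr //; apply: sqr_le_cancel; rewrite ?mulr_ge0 ?csq_ge0 //.
  rewrite -{1}cdotxx adjoint_mx_cdot //; apply: le_trans (cdot_sqr_le _ _) _.
  apply: (@le_trans _ _ (csq x * (a * csq (mx_app T x)))).
    by rewrite ler_wpM2l ?csq_ge0 // adj_le.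
  by rewrite le_eqVlt; apply/orP; left; apply/eqP; ring.
have le2 : (op_norm B <= (b ^+ 2)%:E)%E.
  apply: op_norm_le => [|y]; first exact: sqr_ge0.
  rewrite BE; apply: le_trans (Tbb _) _; rewrite expr2 -[leRHS]mulrA ler_wpM2l ?sqr_ge0 //.
  apply: sqr_le_cancel; rewrite ?mulr_ge0 ?csq_ge0 ?sqr_ge0 //.
  rewrite {1}adj BE; apply: le_trans (cdot_sqr_le _ _) _.
  by rewrite mulrA ler_wpM2r ?csq_ge0 // [leRHS]mulrC Tbb.
rewrite Ba /= Tb; congr (_%:E); apply/eqP; rewrite eq_le.
rewrite Tb Ba !lee_fin in le1 le2; rewrite le1 /=.
by rewrite -(@ler_pXn2r _ 2) ?nnegrE ?sqrtr_ge0 // sqr_sqrtr.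
Qed.

End Adjoint.

(** * Amplification for the column structure of Hilbert spaces *)

Section ColumnAmplification.
Context {R : realType}.

Definition scalar_sq s (d : 'I_s -> R[i]) : R := \sum_l rnorm (d l) ^+ 2.

(** The operator from C^s given by [U] under the column structure, with the one-entry columns that
    [os_mx n 1] puts in the domain stripped off. *)
Definition col_amp {Y : hilbertType R} r s n (U : 'M['cV[Y]_n]_(r, s))
  (d : 'I_s -> R[i]) : 'cV['cV[Y]_n]_r := \col_k \sum_l scale_col (d l) (U k l).

Lemma scalar_norm_le1 s (d : 'cV['cV[R[i]]_1]_s) :
  (col_norm (fun y => col_norm (@rnorm R R[i]) y) d <= 1) =
  (scalar_sq (fun l => d l 0 0 0) <= 1).
Proof.
have -> : col_norm (fun y => col_norm (@rnorm R R[i]) y) d =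
    Num.sqrt (scalar_sq (fun l => d l 0 0 0)).
  congr Num.sqrt; apply: eq_bigr => l _; rewrite sqr_sqrtr.
    by rewrite big_ord1.
  by apply: sumr_ge0 => i _; apply: sqr_ge0.
by rewrite -{1}sqrtr1 ler_psqrt ?nnegrE //; apply: sumr_ge0 => l _; apply: sqr_ge0.
Qed.

Lemma col_act {Y : hilbertType R} r s n (U : 'M['cV[Y]_n]_(r, s)) (d : 'cV['cV[R[i]]_1]_s) :
  mx_act (fun T c => mx_act (fun (y : Y) (c : R[i]) => c *: y) T c) U d =
  col_amp U (fun l => d l 0 0 0).
Proof.
apply/matrixP => k k'; rewrite !mxE; apply: eq_bigr => l _; apply/matrixP => i j.
rewrite [j]ord1 !mxE big_ord1; congr (d l 0 _ 0 *: U k l i _); exact: val_inj.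

Qed.

Lemma os_col_le {Y : hilbertType R} r s n (U : 'M['cV[Y]_n]_(r, s)) M : 0 <= M ->
  (forall d, scalar_sq d <= 1 -> nested_sq (col_amp U d) <= M ^+ 2) ->
  (os_norm (os_mx r s (os_mx n 1 (os_col Y))) U <= M%:E)%E.
Proof.
move=> M0 UM; apply: opnorm_le => d /=; rewrite scalar_norm_le1 => d1.
by rewrite col_act nested_norm_le // UM.
Qed.

Lemma os_col_ge {Y : hilbertType R} r s n (U : 'M['cV[Y]_n]_(r, s)) d :
  scalar_sq d <= 1 ->
  ((col_norm (fun y => col_norm (@rnorm R Y) y) (col_amp U d))%:E <=
    os_norm (os_mx r s (os_mx n 1 (os_col Y))) U)%E.
Proof.
move=> d1; pose d' : 'cV['cV[R[i]]_1]_s := \col_l const_mx (d l).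
have d'E : (fun l => d' l 0 0 0) = d by apply/funext => l; rewrite !mxE.
rewrite -d'E -col_act.
apply: (@opnorm_ge _ _ _ (fun d : 'cV['cV[R[i]]_1]_s =>
  (col_norm (fun y => col_norm (@rnorm R R[i]) y) d)%:E)
  (fun y : 'cV['cV[Y]_n]_r => (col_norm (fun y => col_norm (@rnorm R Y) y) y)%:E)
  (mx_act (fun T c => mx_act (fun (y : Y) (c : R[i]) => c *: y) T c) U) d').
by rewrite lee_fin scalar_norm_le1 d'E.
Qed.

Lemma scalar_sq1 : scalar_sq (fun _ : 'I_1 => 1) = 1.
Proof. by rewrite /scalar_sq big_ord1 rnormC ?ler01 // expr1n. Qed.

Lemma col_amp1 {Y : hilbertType R} n (x : 'cV[Y]_n) :
  col_amp (const_mx x : 'M['cV[Y]_n]_1) (fun=> 1) = const_mx x.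
Proof.
apply/matrixP => k l; rewrite !mxE big_ord1; apply/matrixP => i j.
by rewrite !mxE scale1r.
Qed.

Section Amplify.
Context {X Y : hilbertType R} {p q : nat} (T : 'M[X -> Y]_(p, q)).
Hypothesis bT : forall i j, bounded_op (T i j).

(** A linear map commutes with the scalar combinations by which a matrix over a column space acts,
    so each amplification merely applies [T] to single vectors. *)
Lemma cb_norm_col :
  cb_norm (os_mx q 1 (os_col X)) (os_mx p 1 (os_col Y)) (mx_app T) = op_norm T.
Proof.
have linT : linear_mx T by move=> i j; apply: bounded_op_linear.
have [b b0 Tb] := op_norm_fin bT.
have Tbb x := op_norm_bound bT x b0 (eq_lee Tb).
apply/eqP; rewrite eq_le; apply/andP; split.
  rewrite Tb; apply: ub_ereal_sup => _ [N /= N0 <-].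
  apply: opnorm_lee => U U1; apply: os_col_le => // d d1.
  have := le_trans (os_col_ge U d1) U1.
  rewrite lee_fin nested_norm_le // expr1n => Ud.
  apply: (@le_trans _ _ (b ^+ 2 * nested_sq (col_amp U d))).
    rewrite mulr_sumr; apply: ler_sum => k _; rewrite !mxE.
    have -> : \sum_l scale_col (d l) (map_mx (mx_app T) U k l) =
        mx_app T (\sum_l scale_col (d l) (U k l)).
      rewrite (big_morph (mx_app T) (mx_appD linT) (mx_app0 linT)).
      by apply: eq_bigr => l _; rewrite mxE mx_appZ.
    exact: Tbb.
  by rewrite ler_piMr ?sqr_ge0.
apply: opnorm_lee => x /=; rewrite lee_fin col_norm_le1 => x1.
pose U : 'M['cV[X]_q]_1 := const_mx x.
have U1 : (os_norm (os_mx 1 1 (os_mx q 1 (os_col X))) U <= 1%:E)%E.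
  apply: os_col_le => // d; rewrite /scalar_sq big_ord1 => d1.
  rewrite expr1n /nested_sq big_ord1 mxE big_ord1 csqZ mxE.
  by rewrite mulr_ile1 ?sqr_ge0 ?csq_ge0.
apply: (@le_trans _ _ (amp_norm (os_mx q 1 (os_col X)) (os_mx p 1 (os_col Y)) 1 1 (mx_app T))).
  apply: le_trans (opnorm_ge _ _ U1).
  apply: le_trans (os_col_ge (d := fun=> 1) _ _); last by rewrite scalar_sq1.
  rewrite map_const_mx col_amp1.
  rewrite lee_fin -(@ler_pXn2r _ 2) ?nnegrE ?col_norm_ge0 ?nested_norm_ge0 //.
  by rewrite col_norm_sq nested_norm_sq /nested_sq big_ord1 mxE.
by apply: ereal_sup_ubound; exists 1%N.
Qed.

End Amplify.
End ColumnAmplification.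

(** * Evaluation on H(K) *)

Section ScalarColumns.
Context {R : realType} {A : cstarType R}.

Definition alg_mx p q (c : 'M[R[i]]_(p, q)) : 'M[A]_(p, q) := map_mx (fun z => z%:A) c.

(** The kernel argument depends only on the column u = V c and has the form u u^*, which is what the
    reproducing property produces. *)
Lemma rank_oneE p s (V : 'M[A]_(p, s)) (c : 'cV[R[i]]_s) :
  rank_one V c = (V *m alg_mx c) *m star_mx (V *m alg_mx c).
Proof.
rewrite star_mxM /rank_one !mulmxA; congr (_ *m _); rewrite -!mulmxA; congr (_ *m _).
apply/matrixP => i j; rewrite !mxE !big_ord1 !mxE starZ star1.
by rewrite -scalerAl mul1r scalerA.
Qed.

Lemma scalar_colE s (c : 'cV[R[i]]_s) :
  (col_norm (@rnorm R R[i]) c <= 1) = (scalar_sq (fun l => c l 0) <= 1).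
Proof. by rewrite -{1}sqrtr1 ler_psqrt ?nnegrE //; apply: sumr_ge0 => l _; apply: sqr_ge0. Qed.

Context {E : hilbertType R} (rho : A -> E -> E).
Hypothesis rep : star_rep rho.

Lemma contractive_alg s (c : 'cV[R[i]]_s) : scalar_sq (fun l => c l 0) <= 1 ->
  contractive rho (alg_mx c).
Proof.
move=> c1 x.
have -> : csq (mx_act rho (alg_mx c) x) = scalar_sq (fun l => c l 0) * csq x.
  rewrite /scalar_sq mulr_suml; apply: eq_bigr => l _; rewrite mxE big_ord1 mxE.
  by rewrite (repZ rep) (rep_unit rep) rnormZ exprMn /csq big_ord1.
by rewrite ler_piMl ?csq_ge0.
Qed.

Definition unflat_mx {r m s} (V : 'M[A]_(r * m, s)) : 'M['cV[A]_m]_(r, s) :=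
  \matrix_(k, l) \col_i V (tidx k i) l.

Lemma unflat_mxK r m s (U : 'M['cV[A]_m]_(r, s)) : exists V, unflat_mx V = U.
Proof.
exists (\matrix_(t, l) U (mxtens_unindex t).1 l (mxtens_unindex t).2 0).
apply/matrixP => k l; rewrite !mxE; apply/matrixP => i j.
by rewrite !mxE mxtens_indexK ord1.
Qed.

Lemma unflat_act r m s (V : 'M[A]_(r * m, s)) (x : 'cV['cV[E]_1]_s) k :
  mx_act (fun T y => mx_act rho T y) (unflat_mx V) x k 0 =
  rowsub (tidx k) (mx_act rho V (\col_l x l 0 0 0)).
Proof.
apply/matrixP => i j; rewrite !mxE summxE; apply: eq_bigr => l _.
by rewrite !mxE big_ord1 !mxE; congr (rho _ (x l 0 _ 0)); exact: val_inj.
Qed.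

Lemma unflat_contractive r m s (V : 'M[A]_(r * m, s)) :
  (os_norm (os_mx r s (os_mx m 1 (os_alg rho))) (unflat_mx V) <= 1)%E <-> contractive rho V.
Proof.
split=> [V1 x|cV].
  have := os_alg_nested rep V1 (\col_l \col_(_ < 1) x l 0).
  have -> : nested_sq (\col_l \col_(_ < 1) x l 0) = csq x.
    by apply: eq_bigr => l _; rewrite /csq big_ord1 !mxE.
  rewrite csq_flat /nested_sq; under eq_bigr => k _ do rewrite unflat_act.
  suff -> : \col_l (\col_l0 \col_(_ < 1) x l0 0) l 0 0 0 = x by [].
  by apply/matrixP => l j; rewrite !mxE ord1.
apply: nested_os_alg => x; rewrite /nested_sq.
under eq_bigr => k _ do rewrite unflat_act.
rewrite -csq_flat; apply: le_trans (cV _) _.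
by apply: ler_sum => l _; rewrite mxE csq_entry.
Qed.

End ScalarColumns.

Lemma cdot_le_scale (R : realType) (Y : hilbertType R) n (T : 'M[Y -> Y]_n) t :
  linear_mx T -> (forall y, csq y <= 1 -> cdot (mx_app T y) y <= t) ->
  forall y, cdot (mx_app T y) y <= t * csq y.
Proof.
move=> linT Tt y; have := csq_ge0 y; rewrite le_eqVlt => /predU1P[y0|y0].
  by rewrite (csq_eq0 (esym y0)) (mx_app0 linT) cdot0l csq0 mulr0.
pose c := Num.sqrt (csq y)^-1.
have cc : c * c = (csq y)^-1 by rewrite -expr2 sqr_sqrtr // invr_ge0 ltW.
have := Tt (scale_col c%:C y).
rewrite mx_appZ // cdotZl cdotZr -(cdotxx (scale_col _ _)) cdotZl cdotZr cdotxx !mulrA cc.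
rewrite mulVf ?gt_eqF // => /(_ (lexx _)).
by rewrite mulrC ler_pdivrMr.
Qed.

(** The functional represented by [k] takes the value |k| at k / |k|. If k = 0, the vector 0
    serves. *)
Lemma normalized_element (R : realType) (Y F : hilbertType R) n (L : F -> 'cV[Y]_n) (k : F) y :
  (forall f, cdot (L f) y = rdot f k) -> csq y <= 1 ->
  exists2 f : F, rnorm f <= 1 & rnorm k ^+ 2 <= csq (L f).
Proof.
move=> kP y1; have [k0|k0] := eqVneq (rnorm k) 0.
  by exists 0; rewrite ?rnorm0 // k0 expr0n csq_ge0.
have ik0 : 0 <= (rnorm k)^-1 by rewrite invr_ge0 rnorm_ge0.
exists ((rnorm k)^-1%:C *: k); first by rewrite rnormZ rnormC // mulVf.
have := cdot_sqr_le (L ((rnorm k)^-1%:C *: k)) y.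
have -> : cdot (L ((rnorm k)^-1%:C *: k)) y = rnorm k.
  by rewrite kP rdotZl rdotxx expr2 mulrA mulVf // mul1r.
by move=> /le_trans; apply; rewrite ler_piMr ?csq_ge0.
Qed.

(** * Norms of the amplified point evaluations *)

Section Rkhs.
Context {R : realType} {S : Type} (s0 : S).
Context (Omega : forall n, set 'M[S]_n).
Context {A : cstarType R} {E Y F : hilbertType R} (rho : A -> E -> E).
Variable K : forall n m, 'M[S]_n -> 'M[S]_m -> 'M[A]_(n, m) -> 'M[Y -> Y]_(n, m).
Variable ev : F -> forall n, 'M[S]_n -> 'M[A -> Y]_n.
Hypotheses (rho_faithful : faithful_rep rho) (Omega_nc : nc_set s0 Omega).
Hypotheses (K_global : global_kernel s0 Omega K) (K_cp : cp_kernel Omega K).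
Hypothesis rk : is_rkhs s0 Omega K ev.

Let rep : star_rep rho := proj1 rho_faithful.
Let inj : injective rho := proj2 rho_faithful.

Lemma kernel_op_norm_le n (Z : 'M[S]_n) P t : Omega Z -> pos_mx P -> 0 <= t ->
  (forall y, csq y <= 1 -> cdot (mx_app (K Z Z P) y) y <= t) ->
  (op_norm (K Z Z P) <= t%:E)%E.
Proof.
move=> oZ posP t0 Kt; have linK := kernel_linear K_global P oZ oZ.
apply: op_norm_le => // y; apply: pos_op_bound => //; first exact: K_cp.
exact: cdot_le_scale.
Qed.

Variables (m : nat) (W : 'M[S]_m).
Hypothesis oW : Omega W.

Lemma ev_linear f i j : linear (ev f W i j).
Proof. exact: (proj1 (rk_global rk f)). Qed.

Lemma ev_comb f I (r : seq I) (c : I -> R[i]) (u : I -> 'cV[A]_m) :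
  mx_app (ev f W) (\sum_(l <- r) map_mx ( *:%R (c l)) (u l)) =
  \sum_(l <- r) scale_col (c l) (mx_app (ev f W) (u l)).
Proof.
have eD i j a b : ev f W i j (a + b) = ev f W i j a + ev f W i j b.
  by rewrite -[a]scale1r ev_linear !scale1r.
have e0 i j : ev f W i j 0 = 0 by apply: (addIr (ev f W i j 0)); rewrite -eD !add0r.
have eZ i j z a : ev f W i j (z *: a) = z *: ev f W i j a.
  by rewrite -[z *: a]addr0 ev_linear e0 addr0.
elim: r => [|l r IH].
  by rewrite !big_nil; apply/matrixP => i j; rewrite !mxE big1 // => k _; rewrite mxE e0.
rewrite !big_cons -IH; apply/matrixP => i j; rewrite !mxE scaler_sumr -big_split.
by apply: eq_bigr => k _; rewrite !mxE eD eZ.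
Qed.

Lemma kernel_element (u : 'cV[A]_m) y : exists k : F,
  (forall f, cdot (mx_app (ev f W) u) y = rdot f k) /\
  forall u', mx_app (ev k W) u' = mx_app (K W W (u' *m star_mx u)) y.
Proof.
have [k kP] := rk_mem rk oW (star_mx u) y; exists k; split=> [f|u']; last exact: kP.
by have := rk_rep rk oW kP f; rewrite star_mxK cdotE /rdot => ->.
Qed.

Section Iterated.
Variable r : nat.
Hypothesis r0 : (0 < r)%N.
Let rW := dsum_iter s0 r W.
Let orW : Omega rW. Proof. exact: Omega_iter. Qed.
Implicit Types (u : 'cV[A]_(r * m)) (y : 'cV[Y]_(r * m)).

Definition ev_flat f u : 'cV[Y]_(r * m) := flat (fun k => mx_app (ev f W) (rowsub (tidx k) u)).

(** The element is the sum of the kernel elements of the blocks. Its Gram matrix has the terms <K(W,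
    W)(P_ij) y_j, y_i> with P_ij = u_i u_j^*, the blocks of u u^*. *)
Lemma kernel_element_iter u y : exists k : F,
  (forall f, cdot (ev_flat f u) y = rdot f k) /\
  rnorm k ^+ 2 = cdot (mx_app (K rW rW (u *m star_mx u)) y) y.
Proof.
have /choice [k kP] : forall i : 'I_r, exists k : F,
    (forall f, cdot (mx_app (ev f W) (rowsub (tidx i) u)) (rowsub (tidx i) y) = rdot f k) /\
    forall w, mx_app (ev k W) w =
      mx_app (K W W (w *m star_mx (rowsub (tidx i) u))) (rowsub (tidx i) y).
  by move=> i; apply: kernel_element.
exists (\sum_i k i); split=> [f|].
  rewrite cdot_flat rdot_sumr; apply: eq_bigr => i _.
  by rewrite rowsub_flat (proj1 (kP i)).
rewrite -rdotxx rdot_sumr (kernel_iter_cdot Omega_nc K_global) //.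
apply: eq_bigr => i _; rewrite rdot_suml; apply: eq_bigr => j _.
rewrite -(proj1 (kP i)) (proj2 (kP j)); congr (cdot (mx_app (K W W _) _) _).
by apply/matrixP => a b; rewrite !mxE; apply: eq_bigr => c _; rewrite !mxE.
Qed.

(** The test vector is the value [ev_flat f u] itself: its squared norm is <f, k>, and |k|^2 is at
    most t times that same squared norm. *)
Lemma ev_flat_le f u t : 0 <= t ->
  (forall y, cdot (mx_app (K rW rW (u *m star_mx u)) y) y <= t * csq y) ->
  csq (ev_flat f u) <= rnorm f ^+ 2 * t.
Proof.
move=> t0 Kt; have [k [kP kN]] := kernel_element_iter u (ev_flat f u).
apply: sqr_le_cancel; rewrite ?csq_ge0 ?mulr_ge0 ?rnorm_ge0 //.

rewrite -{1}cdotxx kP; apply: le_trans (rdot_sqr_le _ _) _.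
by rewrite [leRHS]mulrCA ler_wpM2l ?exprn_ge0 ?rnorm_ge0 // kN [leRHS]mulrC Kt.
Qed.

Lemma pos_mx_square u : pos_mx (u *m star_mx u).
Proof.
have [/eqP rm0|] := posnP (r * m)%N.
  exists 0; apply/matrixP => i; have := ltn_ord i; by rewrite {2}(eqP rm0).
move=> rm0; pose i0 : 'I_(r * m) := Ordinal rm0.
(* [pos_mx] asks for a square factor, so u^* is padded with zero rows. A first row exists only in
   positive size, hence the case distinction. *)
exists (\matrix_(i, j) if i == i0 then star (u j 0) else 0).
apply/matrixP => i j; rewrite !mxE big_ord1 (bigD1 i0) //= big1 ?addr0.
  by rewrite !mxE eqxx starK.
by move=> k /negPf ki; rewrite !mxE ki mulr0.
Qed.

Lemma ev_flat_ge u y : csq y <= 1 ->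
  exists2 f : F, rnorm f <= 1 &
    cdot (mx_app (K rW rW (u *m star_mx u)) y) y <= csq (ev_flat f u).
Proof.
move=> y1; have [k [kP <-]] := kernel_element_iter u y.
exact: normalized_element kP y1.
Qed.

(** Since 1 - u u^* is positive, the form of the kernel at u u^* is dominated by the form at the
    unit. *)
Lemma square_le_one u M y : contractive rho u ->
  (forall z, cdot (mx_app (K W W 1%:M) z) z <= M * csq z) ->
  cdot (mx_app (K rW rW (u *m star_mx u)) y) y <= M * csq y.
Proof.
move=> cu WM; have := kernel_iter1_le Omega_nc K_global oW y WM; rewrite -/rW.
have := pos_one_minus rep inj (contractive_star rep cu); rewrite star_mxK => pos1.
have := pos_op_cdot (K_cp orW pos1) y.
have -> : mx_app (K rW rW 1%:M) y = mx_app (K rW rW (1%:M - u *m star_mx u)) y +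
    mx_app (K rW rW (u *m star_mx u)) y by rewrite -(kernelD K_global) // subrK.
by rewrite cdotDl; lra.
Qed.

Lemma ev_amp s (V : 'M[A]_(r * m, s)) (c : 'cV[R[i]]_s) f :
  nested_sq (col_amp (map_mx (mx_app (ev f W)) (unflat_mx V)) (fun l => c l 0)) =
  csq (ev_flat f (V *m alg_mx c)).
Proof.
rewrite csq_flat; apply: eq_bigr => k _; rewrite rowsub_flat mxE.
under eq_bigr => l _ do rewrite mxE.
rewrite -ev_comb; congr (csq (mx_app _ _)); apply/matrixP => i j.
rewrite summxE !mxE; apply: eq_bigr => l _; rewrite !mxE mulr_algr.
by rewrite [j]ord1.
Qed.

End Iterated.

Variables (M : R).
Hypotheses (M0 : 0 <= M) (WM : op_norm (K W W 1%:M) = M%:E).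

Let leM y : cdot (mx_app (K W W 1%:M) y) y <= M * csq y.
Proof. exact: (op_norm_cdot_le K_global K_cp oW M0 (eq_lee WM)). Qed.

Lemma ev_contractive_le r f (u : 'cV[A]_(r * m)) : (0 < r)%N -> contractive rho u ->
  csq (ev_flat f u) <= rnorm f ^+ 2 * M.
Proof. by move=> r0 cu; apply: ev_flat_le => // y; apply: square_le_one. Qed.

Lemma ev_os_norm_le r s f (U : 'M['cV[A]_m]_(r, s)) : (0 < r)%N ->
  (os_norm (os_mx r s (os_mx m 1 (os_alg rho))) U <= 1%:E)%E ->
  (os_norm (os_mx r s (os_mx m 1 (os_col Y))) (map_mx (mx_app (ev f W)) U)
     <= (rnorm f * Num.sqrt M)%:E)%E.
Proof.
have [V <-] := unflat_mxK U => r0 /(unflat_contractive rep) cV.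
apply: os_col_le => [|d d1]; first by rewrite mulr_ge0 ?rnorm_ge0 ?sqrtr_ge0.
have -> : d = (fun l => (\col_l d l : 'cV[R[i]]_s) l 0).
  by apply/funext => l; rewrite mxE.
rewrite ev_amp exprMn sqr_sqrtr //; apply: ev_contractive_le => //.
apply: contractiveM => //; apply: contractive_alg => //.
by rewrite /scalar_sq; under eq_bigr => l _ do rewrite mxE.
Qed.

Lemma ev_cb_norm_le f :
  (cb_norm (os_mx m 1 (os_alg rho)) (os_mx m 1 (os_col Y)) (mx_app (ev f W))
    <= (rnorm f * Num.sqrt M)%:E)%E.
Proof.
apply: ub_ereal_sup => _ [N /= N0 <-]; apply: opnorm_lee => U; exact: ev_os_norm_le.
Qed.

Lemma ev_norm_le r s : (0 < r)%N -> (ev_norm rho ev W r s <= (Num.sqrt M)%:E)%E.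
Proof.
move=> r0; apply: opnorm_lee => f; rewrite lee_fin => f1; apply: opnorm_lee => U U1.
apply: le_trans (ev_os_norm_le f r0 U1) _.
by rewrite lee_fin ler_piMl ?sqrtr_ge0.
Qed.

Lemma ev_norm_ge r s f (U : 'M['cV[A]_m]_(r, s)) : rnorm f <= 1 ->
  (os_norm (os_mx r s (os_mx m 1 (os_alg rho))) U <= 1)%E ->
  (os_norm (os_mx r s (os_mx m 1 (os_col Y))) (map_mx (mx_app (ev f W)) U)
     <= ev_norm rho ev W r s)%E.
Proof.
rewrite -lee_fin => f1 U1.
apply: le_trans (opnorm_ge (nU := fun f : F => (rnorm f)%:E)
  (map_norm (os_mx r s (os_mx m 1 (os_alg rho))) (os_mx r s (os_mx m 1 (os_col Y))))
  (fun f => map_mx (mx_app (ev f W))) f1).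
exact: (opnorm_ge (nU := os_norm (os_mx r s (os_mx m 1 (os_alg rho))))).
Qed.

Lemma ev_norm_fin r s : (0 < r)%N -> exists2 t, 0 <= t & ev_norm rho ev W r s = t%:E.
Proof.
move=> r0; have := ev_norm_le s r0.
have : (0%:E <= ev_norm rho ev W r s)%E.
  have c0 : contractive rho (0 : 'M[A]_(r * m, s)).
    by move=> x; rewrite (rep_mx_zero rep) csq0 csq_ge0.
  have /(unflat_contractive rep) U1 := c0.
  have f0 : rnorm (0 : F) <= 1 by rewrite rnorm0.
  apply: le_trans (ev_norm_ge f0 U1).
  have d0 : scalar_sq (fun _ : 'I_s => 0 : R[i]) <= 1.
    by rewrite /scalar_sq big1 // => l _; rewrite rnormC // expr0n.
  by apply: le_trans (os_col_ge _ d0); rewrite lee_fin nested_norm_ge0.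
by case: (ev_norm _ _ _ _ _) => // t; rewrite lee_fin => t0 _; exists t.
Qed.

(** The unit vector of C^s that tests the output norm serves as [c]. By linearity the tested value
    is [ev_flat f] at V c, so the two inequalities are [ev_flat_le] and [ev_flat_ge]. *)
Lemma ev_norm_sup r s : (0 < r)%N ->
  ev_norm rho ev W r s = ereal_sup
    [set sqrte (op_norm (K (dsum_iter s0 r W) (dsum_iter s0 r W) (rank_one Vc.1 Vc.2)))
    | Vc in [set Vc : 'M[A]_(r * m, s) * 'cV[R[i]]_s |
       (os_norm (os_mx (r * m) s (os_alg rho)) Vc.1 <= 1)%E /\
       ((col_norm (@rnorm R R[i]) Vc.2)%:E <= 1)%E]].
Proof.
move=> r0; have orW := Omega_iter Omega_nc r0 oW.
apply/eqP; rewrite eq_le; apply/andP; split.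
  apply: opnorm_lee => f; rewrite lee_fin => f1; apply: opnorm_lee => U.
  have [V <-] := unflat_mxK U => /(unflat_contractive rep) cV.
  apply: opnorm_lee => d; rewrite lee_fin /= scalar_norm_le1 => d1.
  pose c : 'cV[R[i]]_s := \col_l d l 0 0 0.
  apply: le_trans (ereal_sup_ubound _); last first.
    exists (V, c) => //=; split; first exact: contractive_os_alg.
    rewrite lee_fin scalar_colE /scalar_sq.
    by under eq_bigr => l _ do rewrite mxE.
  rewrite /= rank_oneE; set u := V *m _.
  have [a a0 Ka] := op_norm_fin (fun i j => gk_bounded K_global orW orW (u *m star_mx u) i j).
  rewrite Ka /= lee_fin col_act -(@ler_pXn2r _ 2) ?nnegrE ?nested_norm_ge0 ?sqrtr_ge0 //.
  rewrite nested_norm_sq sqr_sqrtr //.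
  have -> : (fun l => d l 0 0 0) = (fun l => c l 0) by apply/funext => l; rewrite mxE.
  rewrite ev_amp -/u; apply: (@le_trans _ _ (rnorm f ^+ 2 * a)); last first.
    by rewrite ler_piMl // expr_le1 ?rnorm_ge0.
  apply: ev_flat_le => // y.
  have posK := K_cp orW (pos_mx_square u).
  rewrite -(@ler_pXn2r _ 2) ?nnegrE ?(pos_op_cdot posK) ?mulr_ge0 ?csq_ge0 //.
  apply: le_trans (cdot_sqr_le _ _) _; rewrite exprMn expr2 [csq y ^+ 2]expr2 mulrA.
  rewrite ler_wpM2r ?csq_ge0 // -expr2; apply: op_norm_bound => //; last exact: eq_lee.
  by move=> i j; apply: (gk_bounded K_global).
apply: ub_ereal_sup => _ [[V c] /= [V1 c1] <-]; rewrite lee_fin scalar_colE in c1.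
have [t t0 evt] := ev_norm_fin s r0; rewrite evt rank_oneE; set u := V *m _.
have : (op_norm (K (dsum_iter s0 r W) (dsum_iter s0 r W) (u *m star_mx u)) <= (t ^+ 2)%:E)%E.
  apply: kernel_op_norm_le => // [||y y1]; [exact: pos_mx_square|exact: sqr_ge0|].
  have [f f1 /le_trans] := ev_flat_ge u y1; apply.
  rewrite -ev_amp -nested_norm_sq ler_pXn2r ?nnegrE ?nested_norm_ge0 // -lee_fin -evt.
  apply: le_trans (os_col_ge _ c1) _.
  by apply: ev_norm_ge => //; apply/(unflat_contractive rep)/(os_alg_contractive rep).
have [a a0 ->] := op_norm_fin (fun i j => gk_bounded K_global orW orW (u *m star_mx u) i j).
rewrite /= !lee_fin => at2.
by rewrite -(@ler_pXn2r _ 2) ?nnegrE ?sqrtr_ge0 // sqr_sqrtr.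
Qed.

End Rkhs.

(** * Evaluation at points of size one *)

Section SinglePoint.
Context {R : realType} {S : Type} (s0 : S).
Context (Omega : forall n, set 'M[S]_n).
Context {A : cstarType R} {E Y F : hilbertType R} (rho : A -> E -> E).
Variable K : forall n m, 'M[S]_n -> 'M[S]_m -> 'M[A]_(n, m) -> 'M[Y -> Y]_(n, m).
Variable ev : F -> forall n, 'M[S]_n -> 'M[A -> Y]_n.
Hypotheses (rho_faithful : faithful_rep rho) (Omega_nc : nc_set s0 Omega).
Hypotheses (K_global : global_kernel s0 Omega K) (K_cp : cp_kernel Omega K).
Hypothesis rk : is_rkhs s0 Omega K ev.
Variables (W : 'M[S]_1) (M : R).
Hypotheses (oW : Omega W) (M0 : 0 <= M) (WM : op_norm (K W W 1%:M) = M%:E).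

Let rep : star_rep rho := proj1 rho_faithful.

Definition ev1 (f : F) : A -> Y := ev f W ord0 ord0.

Lemma csq_ev1 f a : csq (mx_app (ev f W) (const_mx a)) = rnorm (ev1 f a) ^+ 2.
Proof. by rewrite /csq big_ord1 mxE big_ord1 mxE. Qed.

(** In size one the unit matrix is u u^* for the column u = 1, so evaluating at the unit of [A]
    already exhausts the norm. This is the common lower bound for the three norms below. *)
Lemma ev1_lower t : 0 <= t -> (forall f, rnorm f <= 1 -> rnorm (ev1 f 1) <= t) ->
  Num.sqrt M <= t.
Proof.
move=> t0 evt; rewrite -(@ler_pXn2r _ 2) ?nnegrE ?sqrtr_ge0 // sqr_sqrtr // -lee_fin -WM.
apply: (kernel_op_norm_le K_global K_cp oW (pos_mx1 1)) => [|y y1]; first exact: sqr_ge0.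
have [k [kP kK]] := kernel_element rk oW (const_mx 1) y.
have [f f1] := normalized_element kP y1.
rewrite csq_ev1 -rdotxx -kP kK.
have -> : (const_mx 1 : 'cV[A]_1) *m star_mx (const_mx 1) = 1%:M.
  by apply/matrixP => i j; rewrite !mxE big_ord1 !mxE star1 mulr1 !ord1 eqxx.
by move=> /le_trans; apply; rewrite ler_pXn2r ?nnegrE ?rnorm_ge0 // evt.
Qed.

Lemma ev1_contractive_le f N (a : 'cV[A]_N) : (0 < N)%N -> contractive rho a ->
  \sum_k rnorm (ev1 f (a k 0)) ^+ 2 <= rnorm f ^+ 2 * M.
Proof.
move=> N0 ca; pose u : 'cV[A]_(N * 1) := flat (fun k => const_mx (a k 0)).
have cu : contractive rho u.
  move=> x; rewrite csq_flat; apply: le_trans (ca x).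
  apply: ler_sum => k _; rewrite /csq big_ord1 !mxE !big_ord1 !mxE mxtens_indexK.
  exact: lexx.
apply: le_trans (ev_contractive_le rho_faithful Omega_nc K_global K_cp rk oW M0 WM f N0 cu).
rewrite csq_flat; apply: ler_sum => k _.
by rewrite !rowsub_flat csq_ev1.
Qed.

Lemma ev1_le f a : cnorm a <= 1 -> rnorm (ev1 f a) <= rnorm f * Num.sqrt M.
Proof.
move=> a1; rewrite -(@ler_pXn2r _ 2) ?nnegrE ?mulr_ge0 ?sqrtr_ge0 ?rnorm_ge0 //.
rewrite exprMn sqr_sqrtr //.
have := @ev1_contractive_le f 1 (const_mx a) isT; rewrite big_ord1 mxE; apply.
move=> x; rewrite /csq !big_ord1 mxE big_ord1 mxE.
by rewrite ler_pXn2r ?nnegrE ?rnorm_ge0 ?(rep_contractive rep).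
Qed.

Lemma ev1_cb_le f : (cb_norm (os_alg rho) (os_col Y) (ev1 f) <= (rnorm f * Num.sqrt M)%:E)%E.
Proof.
apply: ub_ereal_sup => _ [N /= N0 <-]; apply: opnorm_lee => V V1.
apply: opnorm_le => c; rewrite scalar_colE => c1.
rewrite col_norm_le ?mulr_ge0 ?rnorm_ge0 ?sqrtr_ge0 // exprMn sqr_sqrtr //.
have cu : contractive rho (V *m alg_mx c).
  by apply: (contractiveM rep); [exact: os_alg_contractive|exact: contractive_alg].
apply: le_trans (ev1_contractive_le f N0 cu).
apply: ler_sum => k _; rewrite !mxE.
have linf : linear (ev1 f) := ev_linear rk oW f ord0 ord0.
have eD a b : ev1 f (a + b) = ev1 f a + ev1 f b.
  by rewrite -[a]scale1r linf !scale1r.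
have e0 : ev1 f 0 = 0 by apply: (addIr (ev1 f 0)); rewrite -eD !add0r.
have eZ z a : ev1 f (z *: a) = z *: ev1 f a.
  by rewrite -[z *: a]addr0 linf e0 addr0.
rewrite (big_morph (ev1 f) eD e0) le_eqVlt; apply/orP; left; apply/eqP.
congr (rnorm _ ^+ 2); apply: eq_bigr => l _.
by rewrite !mxE mulr_algr eZ.
Qed.

Lemma ev1_ev_norm : ev_norm rho ev W 1 1 = (Num.sqrt M)%:E.
Proof.
have [t t0 evt] := ev_norm_fin rho_faithful Omega_nc K_global K_cp rk oW M0 WM 1 (ltn0Sn 0).
apply/eqP; rewrite eq_le; apply/andP; split.
  exact: (ev_norm_le rho_faithful Omega_nc K_global K_cp rk oW M0 WM).
rewrite evt lee_fin; apply: ev1_lower => // f f1.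
pose U : 'M['cV[A]_1]_1 := const_mx (const_mx 1).
have U1 : (os_norm (os_mx 1 1 (os_mx 1 1 (os_alg rho))) U <= 1)%E.
  apply: nested_os_alg => x; rewrite /nested_sq !big_ord1 /csq !big_ord1.
  by rewrite !mxE !big_ord1 !mxE big_ord1 mxE (rep_unit rep) lexx.
have d1 : scalar_sq (fun _ : 'I_1 => 1 : R[i]) <= 1 by rewrite scalar_sq1.
have := le_trans (os_col_ge _ d1) (ev_norm_ge ev W f1 U1).
rewrite evt lee_fin map_const_mx col_amp1 nested_norm_le // /nested_sq big_ord1 mxE csq_ev1.
by rewrite ler_pXn2r ?nnegrE ?rnorm_ge0.
Qed.

Lemma ev1_opnorm :
  opnorm (fun f : F => (rnorm f)%:E)
    (opnorm (fun a : A => (cnorm a)%:E) (fun y : Y => (rnorm y)%:E)) ev1 = (Num.sqrt M)%:E.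
Proof.
set t := opnorm _ _ _.
have lb f : rnorm f <= 1 -> ((rnorm (ev1 f 1))%:E <= t)%E.
  rewrite -lee_fin => f1; apply: le_trans (opnorm_ge _ _ f1).
  by apply: (@opnorm_ge _ _ _ _ (fun y : Y => (rnorm y)%:E) _ 1); rewrite lee_fin cnorm1.
have ub : (t <= (Num.sqrt M)%:E)%E.
  apply: opnorm_lee => f; rewrite lee_fin => f1; apply: opnorm_le => a a1.
  apply: le_trans (ev1_le f a1) _; by rewrite ler_piMl ?sqrtr_ge0.
have f0 : rnorm (0 : F) <= 1 by rewrite rnorm0.
move: t ub lb => [t||] //; last first.
  by move=> _ /(_ 0 f0).
rewrite !lee_fin => ub lb; congr (_%:E); apply/eqP; rewrite eq_le ub /=.
apply: ev1_lower => [|f f1]; last by rewrite -lee_fin lb.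
by apply: (le_trans (rnorm_ge0 (ev1 0 1))); rewrite -lee_fin lb.
Qed.

Lemma ev1_cb_opnorm :
  opnorm (fun f : F => (rnorm f)%:E) (cb_norm (os_alg rho) (os_col Y)) ev1 = (Num.sqrt M)%:E.
Proof.
set t := opnorm _ _ _.
have lb f : rnorm f <= 1 -> ((rnorm (ev1 f 1))%:E <= t)%E.
  rewrite -lee_fin => f1; apply: le_trans (opnorm_ge _ _ f1).
  apply: (@le_trans _ _ (amp_norm (os_alg rho) (os_col Y) 1 1 (ev1 f))); last first.
    by apply: ereal_sup_ubound; exists 1%N.
  have c1 : contractive rho (const_mx 1 : 'M[A]_1).
    by move=> x; rewrite /csq !big_ord1 mxE big_ord1 mxE (rep_unit rep) lexx.
  apply: le_trans (opnorm_ge _ _ (contractive_os_alg c1)).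
  have d1 : ((col_norm (@rnorm R R[i]) (const_mx 1 : 'cV_1))%:E <= 1%:E)%E.
    by rewrite lee_fin scalar_colE /scalar_sq big_ord1 mxE rnormC // expr1n.
  apply: le_trans (@opnorm_ge _ _ _ _ (fun y : 'cV[Y]_1 => (col_norm (@rnorm R Y) y)%:E) _ _ d1).
  rewrite lee_fin -(@ler_pXn2r _ 2) ?nnegrE ?rnorm_ge0 ?col_norm_ge0 // col_norm_sq.
  by rewrite /csq big_ord1 !mxE big_ord1 !mxE /= scale1r.
have ub : (t <= (Num.sqrt M)%:E)%E.
  apply: opnorm_lee => f; rewrite lee_fin => f1; apply: le_trans (ev1_cb_le f) _.
  by rewrite lee_fin ler_piMl ?sqrtr_ge0.
have f0 : rnorm (0 : F) <= 1 by rewrite rnorm0.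
move: t ub lb => [t||] //; last first.
  by move=> _ /(_ 0 f0).
rewrite !lee_fin => ub lb; congr (_%:E); apply/eqP; rewrite eq_le ub /=.
apply: ev1_lower => [|f f1]; last by rewrite -lee_fin lb.
by apply: (le_trans (rnorm_ge0 (ev1 0 1))); rewrite -lee_fin lb.
Qed.

End SinglePoint.

(** The amplification of size 1 suffices; with [P] the unit it makes the cb bound at a doubled point
    sharp. *)
Lemma cb_norm_ge_op_norm (R : realType) (A : cstarType R) (E X Y : hilbertType R)
    (rho : A -> E -> E) n m (phi : 'M[A]_(n, m) -> 'M[X -> Y]_(n, m)) P :
  contractive rho P ->
  (op_norm (phi P) <= cb_norm (os_mx n m (os_alg rho)) (os_mx n m (os_op X Y)) phi)%E.
Proof.
move=> cP.
apply: (@le_trans _ _ (amp_norm (os_mx n m (os_alg rho)) (os_mx n m (os_op X Y)) 1 1 phi));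
  last by apply: ereal_sup_ubound; exists 1%N.
have U1 : (os_norm (os_mx 1 1 (os_mx n m (os_alg rho))) (const_mx P) <= 1%:E)%E.
  apply: nested_os_alg => x; rewrite /nested_sq !big_ord1 mxE big_ord1 mxE.
  exact: cP.
apply: le_trans (opnorm_ge _ _ U1); apply: opnorm_lee => y y1.
have y1' : ((col_norm (fun y => col_norm (@rnorm R X) y) (const_mx y : 'cV['cV[X]_m]_1))%:E
    <= 1%:E)%E.
  by rewrite lee_fin nested_norm_le // expr1n /nested_sq big_ord1 mxE -col_norm_le1.
apply: le_trans (@opnorm_ge _ _ _ _
  (fun y : 'cV['cV[Y]_n]_1 => (col_norm (fun y => col_norm (@rnorm R Y) y) y)%:E) _ _ y1').
rewrite lee_fin -(@ler_pXn2r _ 2) ?nnegrE ?col_norm_ge0 ?nested_norm_ge0 //.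
by rewrite nested_norm_sq /nested_sq big_ord1 col_norm_sq !mxE big_ord1 !mxE.
Qed.

Local Open Scope ereal_scope.

Theorem proposition3p11 (R : realType) (S : Type) (s0 : S)
    (Omega : forall n : nat, set 'M[S]_n) (A : cstarType R)
    (E : hilbertType R) (rho : A -> E -> E) (Y : hilbertType R)
    (K : forall n m : nat,
       'M[S]_n -> 'M[S]_m -> 'M[A]_(n, m) -> 'M[Y -> Y]_(n, m))
    (rho_faithful : faithful_rep rho)
    (Omega_nc : nc_set s0 Omega)
    (K_global : global_kernel s0 Omega K)
    (K_cp : cp_kernel Omega K) :
  [/\ (* (1) *)
      (forall (n m : nat) (Z : 'M[S]_n) (W : 'M[S]_m),
         Omega n Z -> Omega m W ->
         let cbK := cb_norm (os_mx n m (os_alg rho)) (os_mx n m (os_op Y Y))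
                      (K n m Z W) in
         let ZW := dsum s0 Z W in
         [/\ cbK < +oo,
             cbK <= op_norm (K _ _ ZW ZW 1%:M) &
             op_norm (K _ _ ZW ZW 1%:M) =
               maxe (op_norm (K n n Z Z 1%:M)) (op_norm (K m m W W 1%:M))]) /\
      (forall (n : nat) (Z : 'M[S]_n), Omega n Z ->
         let ZZ := dsum s0 Z Z in
         cb_norm (os_mx (n + n) (n + n) (os_alg rho))
                 (os_mx (n + n) (n + n) (os_op Y Y)) (K _ _ ZZ ZZ) =
         op_norm (K n n Z Z 1%:M)),
      (* (2) *)
      (forall (F : hilbertType R)
              (ev : F -> forall n : nat, 'M[S]_n -> 'M[A -> Y]_n),
         is_rkhs s0 Omega K ev ->
         (forall (m : nat) (W : 'M[S]_m), Omega m W ->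
            (forall f : F,
               let cbf := cb_norm (os_mx m 1 (os_alg rho))
                            (os_mx m 1 (os_col Y)) (mx_app (ev f m W)) in
               cbf < +oo /\
               cbf <= (rnorm f)%:E * sqrte (op_norm (K m m W W 1%:M))) /\
            (forall r s : nat, (0 < r)%N -> (0 < s)%N ->
               let rW := dsum_iter s0 r W in
               ev_norm rho ev W r s =
                 ereal_sup
                   [set sqrte (op_norm (K _ _ rW rW (rank_one Vc.1 Vc.2)))
                   | Vc in [set Vc : 'M[A]_(r * m, s) * 'cV[R[i]]_s |
                       os_norm (os_mx (r * m) s (os_alg rho)) Vc.1 <= 1 /\
                       (col_norm (@rnorm R R[i]) Vc.2)%:E <= 1]] /\
               ev_norm rho ev W r s <= sqrte (op_norm (K m m W W 1%:M)))) /\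
         (forall W : 'M[S]_1, Omega 1%N W ->
            let evW := fun f : F => ev f 1%N W ord0 ord0 in
            let nF := fun f : F => (rnorm f)%:E in
            let k := sqrte (op_norm (K 1%N 1%N W W 1%:M)) in
            [/\ ev_norm rho ev W 1 1 = k,
                opnorm nF (opnorm (fun a : A => (cnorm a)%:E)
                                  (fun y : Y => (rnorm y)%:E)) evW = k &
                opnorm nF (cb_norm (os_alg rho) (os_col Y)) evW = k])) &
      (* (3) *)
      (forall (X : hilbertType R) (sigma : A -> X -> X)
              (H : forall n : nat, 'M[S]_n -> 'M[X -> Y]_n),
         kolmogorov s0 Omega K sigma H ->
         forall (n : nat) (Z : 'M[S]_n), Omega n Z ->
           let cbH := cb_norm (os_mx n 1 (os_col X)) (os_mx n 1 (os_col Y))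
                        (mx_app (H n Z)) in
           [/\ cbH < +oo,
               cbH = op_norm (H n Z) &
               op_norm (H n Z) = sqrte (op_norm (K n n Z Z 1%:M))])].

Proof.
have opK n (Z : 'M[S]_n) : Omega n Z ->
    exists2 a : R, (0 <= a)%R & op_norm (K n n Z Z 1%:M) = a%:E.
  by move=> oZ; apply: op_norm_fin => i j; apply: (gk_bounded K_global).
split.
- split=> [n m Z W oZ oW cbK ZW|n Z oZ ZZ].
    have le_cb : cbK <= op_norm (K _ _ ZW ZW 1%:M).
      exact: (cb_norm_kernel_le rho_faithful Omega_nc K_global K_cp oZ oW).
    split=> //; last exact: (op_norm_dsum Omega_nc K_global oZ oW).
    have [a _ Ka] := opK _ _ (Omega_dsum Omega_nc oZ oW).
    by apply: le_lt_trans le_cb _; rewrite Ka ltry.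
  have oZZ : Omega _ ZZ := Omega_dsum Omega_nc oZ oZ.
  have eZ : op_norm (K n n Z Z 1%:M) = op_norm (K _ _ ZZ ZZ 1%:M).
    by rewrite (op_norm_dsum Omega_nc K_global oZ oZ) maxxx.
  (* The upper bound is the general one for the pair [ZZ], [ZZ]; the maximum of two equal norms
     removes the extra doubling. *)
  rewrite eZ; apply/eqP; rewrite eq_le; apply/andP; split.
    have := cb_norm_kernel_le rho_faithful Omega_nc K_global K_cp oZZ oZZ.
    by rewrite (op_norm_dsum Omega_nc K_global oZZ oZZ) maxxx.
  by apply: cb_norm_ge_op_norm; apply: (contractive1 (proj1 rho_faithful)).
- move=> F ev rk; split=> [m W oW|W oW evW nF k]; have [a a0 Ka] := opK _ _ oW.
    split=> [f cbf|r s r0 s1 rW].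
      have le_cb : cbf <= (rnorm f)%:E * sqrte (op_norm (K m m W W 1%:M)).
        rewrite Ka -EFinM.
        exact: (ev_cb_norm_le rho_faithful Omega_nc K_global K_cp rk oW a0 Ka).
      by split=> //; apply: le_lt_trans le_cb _; rewrite Ka -EFinM ltry.
    split; first exact: (ev_norm_sup rho_faithful Omega_nc K_global K_cp rk oW a0 Ka).
    by rewrite Ka; apply: (ev_norm_le rho_faithful Omega_nc K_global K_cp rk oW a0 Ka).
  have kE : k = (Num.sqrt a)%:E by rewrite /k Ka.
  rewrite kE; split.
  + exact: (ev1_ev_norm rho_faithful Omega_nc K_global K_cp rk oW a0 Ka).
  + exact: (ev1_opnorm rho_faithful Omega_nc K_global K_cp rk oW a0 Ka).
  + exact: (ev1_cb_opnorm rho_faithful Omega_nc K_global K_cp rk oW a0 Ka).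
- move=> X sigma H kol n Z oZ cbH.
  have bH i j : bounded_op (H n Z i j) := proj1 (kol_global kol) n Z oZ i j.
  have cbE : cbH = op_norm (H n Z) by apply: cb_norm_col.
  have opE : op_norm (H n Z) = sqrte (op_norm (K n n Z Z 1%:M)).
    apply: op_norm_adjoint => // [i j|y]; first exact: (gk_bounded K_global).
    (* At the unit the middle factor is [sigma] applied to the identity matrix, which acts as the
       identity because [sigma] is unital. *)
    rewrite (kol_eq kol oZ oZ); congr mx_app; rewrite -[RHS](rep_mx1 (kol_rep kol)).
    by apply/matrixP => i j; rewrite !mxE; apply: eq_bigr => l _; rewrite !mxE.
  have [a _ Ka] := opK _ _ oZ.
  by split=> //; rewrite cbE opE Ka ltry.
Qed.
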